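(* Let $q$ be a bounded complex-valued measurable function on $\mathbb R_+$, $\alpha\in\mathbb C\cup\{\infty\}$, let $H$ be the operator $Hf=-f''+qf$ on $L^2(\mathbb R_+)$ with boundary condition $f'(0)+\alpha f(0)=0$, and let $(\nu,\psi)$ be the spectral pair of $H$. Let $\lambda>0$ be a simple eigenvalue of $|H|=\sqrt{H^*H}$ and let $e$ be the distinguished solution, i.e. the function, unique up to multiplication by $\pm1$, with $\|e\|_{L^2(\mathbb R_+)}=1$, $-e''+qe=\lambda\overline e$ and $e'(0)+\alpha e(0)=0$. Define $$\ell_\alpha(e)=\frac{\overline\alpha e'(0)-e(0)}{\sqrt{1+|\alpha|^2}}\ \text{ if }\alpha\in\mathbb C,\qquad \ell_\infty(e)=e'(0)\ \text{ if }\alpha=\infty.$$ Then $\ell_\alpha(e)\ne0$ and $$\nu(\{\lambda\})=\frac12|\ell_\alpha(e)|^2,\qquad \psi(\lambda)=\frac{\overline{\ell_\alpha(e)^2}}{|\ell_\alpha(e)|^2}.$$ In particular, $|\psi(\lambda)|=1$.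
   Context: Notation: $\mathbb R_+=(0,\infty)$, $\epsilon=\begin{pmatrix}0&1\\1&0\end{pmatrix}$, $I$ is the $2\times2$ identity matrix, and $\operatorname{Re}M=\frac12(M+M^* )$ for a matrix $M$. For $\alpha=\infty$ the boundary condition $f'(0)+\alpha f(0)=0$ means $f(0)=0$; the domain of $H$ is the set of $f\in W^{2,2}([0,\infty))$ satisfying the boundary condition. Hermitisation: let $Q=\begin{pmatrix}0&q\\\overline q&0\end{pmatrix}$, $A=\begin{pmatrix}\overline\alpha&0\\0&\alpha\end{pmatrix}$, and let $\mathbf H F=-\epsilon F''+QF$ in $L^2(\mathbb R_+;\mathbb C^2)$ with domain $\{F\in W^{2,2}([0,\infty);\mathbb C^2): F'(0)+AF(0)=0\}$ ($F(0)=0$ if $\alpha=\infty$). This is the self-adjoint operator $\begin{pmatrix}0&H\\H^*&0\end{pmatrix}$. Spectral measure of $\mathbf H$: put $S=\frac{1}{\sqrt{1+|\alpha|^2}}I$, $C=\frac1{\sqrt{1+|\alpha|^2}}\epsilon A$ if $\alpha\in\mathbb C$, and $S=0$, $C=\epsilon$ if $\alpha=\infty$. For $z\in\mathbb C$ let $\Phi(x,z),\Theta(x,z)$ be the $2\times2$ matrix solutions of $-\epsilon F''+QF=zF$, $x>0$, with $\Phi(0,z)=S$, $\epsilon\Phi'(0,z)=-C$, $\Theta(0,z)=C$, $\epsilon\Theta'(0,z)=S$. For $z\in\mathbb C\setminus\mathbb R$, $M_\alpha(z)$ is the unique $2\times2$ matrix such that both columns of $\Theta(x,z)-\Phi(x,z)M_\alpha(z)$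 belong to $L^2(\mathbb R_+;\mathbb C^2)$. One has $$M_\alpha(z)=\operatorname{Re}M_\alpha(\mathrm i)+\int_{-\infty}^\infty\Bigl(\frac1{t-z}-\frac t{1+t^2}\Bigr)\,d\Sigma(t),\qquad z\in\mathbb C\setminus\mathbb R,$$ with a unique (positive semi-definite) $2\times2$ matrix-valued measure $\Sigma$ on $\mathbb R$ such that $\int_{\mathbb R}\frac{d\Sigma(t)}{1+t^2}$ converges; $\Sigma$ is the spectral measure of $\mathbf H$. Spectral pair: there exist a unique even positive measure $\nu$ on $\mathbb R$ and a unique odd complex-valued $\psi\in L^\infty(\nu)$ with $|\psi|\le1$ $\nu$-a.e. such that $d\Sigma=\begin{pmatrix}1&\psi\\\overline\psi&1\end{pmatrix}d\nu$. The pair $(\nu,\psi)$ is called the spectral pair of $H$; $\psi$ is defined up to $\nu$-null sets. A simple eigenvalue is one whose eigenspace is one-dimensional; the existence and uniqueness up to sign of the distinguished solution $e$ for a simple eigenvalue $\lambda>0$ of $|H|$ is known. *)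

(* Defs.v *)
From mathcomp Require Import all_boot all_order all_algebra.
From mathcomp Require Import all_classical all_reals all_analysis.
From mathcomp Require Import complex.

Set Implicit Arguments.
Unset Strict Implicit.
Unset Printing Implicit Defensive.

Import Order.TTheory GRing.Theory Num.Theory.
Import numFieldNormedType.Exports.

Local Open Scope classical_set_scope.
Local Open Scope ring_scope.
Local Open Scope complex_scope.

Local Notation Re := complex.Re.
Local Notation Im := complex.Im.

Section complex_integration.
Context {R : realType}.
Local Notation C := (R[i]).
Implicit Types (mu : {measure set (measurableTypeR R) -> \bar R}) (D : set R).

Definition cabs (z : C) : R := Normc.normc z.

Definition cmeasurable D (f : R -> C) : Prop :=
  measurable_fun D (fun x => Re (f x)) /\ measurable_fun D (fun x => Im (f x)).

Definition cintegrable mu D (f : R -> C) : Prop :=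
  mu.-integrable D (fun x => (Re (f x))%:E) /\
  mu.-integrable D (fun x => (Im (f x))%:E).

Definition cintegral mu D (f : R -> C) : C :=
  Rintegral mu D (fun x => Re (f x)) +i* Rintegral mu D (fun x => Im (f x)).

End complex_integration.

Section half_line.
Context {R : realType}.
Local Notation C := (R[i]).

Definition Rplus : set R := `]0, +oo[.

Definition ae_equal (f g : R -> C) : Prop := ae_eq (@lebesgue_measure R) Rplus f g.

(* [measurable_fun] refers to the Borel sigma-algebra; a function is Lebesgue
   measurable iff it agrees a.e. with a Borel function. *)
Definition lebesgue_measurable (f : R -> C) : Prop :=
  exists2 g, cmeasurable Rplus g & ae_equal f g.

(* Elements of L^2(R_+) are represented by Borel functions; only their values
   on ]0, +oo[, up to [ae_equal], are relevant. *)
Definition L2 (f : R -> C) : Prop :=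
  cmeasurable Rplus f /\
  (@lebesgue_measure R).-integrable Rplus (fun x => (cabs (f x) ^+ 2)%:E).

Definition L2norm (f : R -> C) : R :=
  Num.sqrt (Rintegral (@lebesgue_measure R) Rplus (fun x => cabs (f x) ^+ 2)).

Definition inner (f g : R -> C) : C :=
  cintegral (@lebesgue_measure R) Rplus (fun x => f x * conjc (g x)).

(* [f] is locally absolutely continuous on [0, +oo[ with f' = g a.e. *)
Definition primitive (f g : R -> C) : Prop :=
  forall x : R, 0 <= x ->
    cintegrable (@lebesgue_measure R) `[0, x] g /\
    f x = f 0 + cintegral (@lebesgue_measure R) `[0, x] g.

Definition W22 (f f' f'' : R -> C) : Prop :=
  [/\ primitive f f', primitive f' f'', L2 f, L2 f' & L2 f''].

(* [None] stands for alpha = infinity. *)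
Definition bc (alpha : option C) (f0 f0' : C) : Prop :=
  if alpha is Some a then f0' + a * f0 = 0 else f0 = 0.

End half_line.

(* An unbounded operator in L^2(R_+) is given by its graph: [T f g] means that
   f is in the domain of T and T f = g. *)
Section operators.
Context {R : realType}.
Local Notation C := (R[i]).
Definition op := (R -> C) -> (R -> C) -> Prop.
Implicit Types T S P : op.

Definition densely_defined T : Prop :=
  forall f, L2 f -> forall eps : R, 0 < eps ->
    exists u v, T u v /\ L2norm (fun x => f x - u x) < eps.

Definition op_adjoint T : op := fun f g =>
  [/\ L2 f, L2 g & forall u v, T u v -> inner v f = inner u g].

Definition op_comp S T : op := fun f h => exists g, T f g /\ S g h.

Definition op_eq S T : Prop := forall f g, S f g <-> T f g.

Definition selfadjoint T : Prop :=
  densely_defined T /\ op_eq T (op_adjoint T).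

Definition nonnegative T : Prop := forall f g, T f g -> 0 <= inner g f.

(* P = |T| = sqrt (T^* T), the nonnegative self-adjoint square root. *)
Definition is_modulus T P : Prop :=
  [/\ selfadjoint P, nonnegative P & op_eq (op_comp P P) (op_comp (op_adjoint T) T)].

Definition eigenvector T (lam : C) (f : R -> C) : Prop := T f (fun x => lam * f x).

Definition simple_eigenvalue T (lam : C) : Prop :=
  exists f, [/\ eigenvector T lam f, ~ ae_equal f (fun=> 0) &
    forall g, eigenvector T lam g ->
      exists c : C, ae_equal g (fun x => c * f x)].

(* The operator H : f |-> - f'' + q f with f'(0) + alpha f(0) = 0; [u] is the
   continuously differentiable representative of the class of [f]. *)
Definition schrodinger (q : R -> C) (alpha : option C) : op := fun f g =>
  exists u u' u'',
    [/\ W22 u u' u'', bc alpha (u 0) (u' 0),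
        L2 f /\ ae_equal f u &
        L2 g /\ ae_equal g (fun x => - u'' x + q x * u x)].

End operators.

Section hermitisation.
Context {R : realType}.
Local Notation C := (R[i]).

Definition mx2 (a b c d : C) : 'M[C]_2 :=
  \matrix_(i, j) if i == 0 then (if j == 0 then a else b)
                 else (if j == 0 then c else d).

Definition epsmx : 'M[C]_2 := mx2 0 1 1 0.

Definition Qmx (q : R -> C) (x : R) : 'M[C]_2 := mx2 0 (q x) (conjc (q x)) 0.

Definition Amx (a : C) : 'M[C]_2 := mx2 (conjc a) 0 0 a.

Definition japanese_bracket (a : C) : C := (Num.sqrt (1 + cabs a ^+ 2))%:C.

Definition Smx (alpha : option C) : 'M[C]_2 :=
  if alpha is Some a then (japanese_bracket a)^-1 *: 1%:M else 0.

Definition Cmx (alpha : option C) : 'M[C]_2 :=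
  if alpha is Some a then (japanese_bracket a)^-1 *: (epsmx *m Amx a) else epsmx.

Definition adjmx n (M : 'M[C]_n) : 'M[C]_n := (map_mx conjc M)^T.

Definition Remx (M : 'M[C]_2) : 'M[C]_2 := (1 / 2) *: (M + adjmx M).

Definition mx_primitive (F G : R -> 'M[C]_2) : Prop :=
  forall i j, primitive (fun x => F x i j) (fun x => G x i j).

(* Since q is only measurable, solutions are understood in the Caratheodory
   sense: F and F' are locally absolutely continuous on [0, +oo[ and the
   equation holds a.e. *)
Definition mx_solution (q : R -> C) (z : C) (F F' : R -> 'M[C]_2) : Prop :=
  exists F'' : R -> 'M[C]_2,
    [/\ mx_primitive F F', mx_primitive F' F'' &
        ae_eq (@lebesgue_measure R) Rplus
          (fun x => - (epsmx *m F'' x) + Qmx q x *m F x) (fun x => z *: F x)].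

Definition is_Mfunction (q : R -> C) (alpha : option C) (z : C) (M : 'M[C]_2) : Prop :=
  exists Phi Phi' Theta Theta' : R -> 'M[C]_2,
    [/\ mx_solution q z Phi Phi' /\ mx_solution q z Theta Theta',
        Phi 0 = Smx alpha /\ epsmx *m Phi' 0 = - Cmx alpha,
        Theta 0 = Cmx alpha /\ epsmx *m Theta' 0 = Smx alpha &
        forall i j, L2 (fun x => (Theta x - Phi x *m M) i j)].

End hermitisation.

(* A matrix-valued measure is in general only defined on bounded Borel sets;
   the values of [Sigma] elsewhere are irrelevant. *)
Section matrix_measures.
Context {R : realType}.
Local Notation C := (R[i]).
Implicit Types (Sigma : set R -> 'M[C]_2) (B : set R).

Definition bounded_borel B : Prop :=
  measurable (B : set (measurableTypeR R)) /\ bounded_set B.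

Definition quadform (M : 'M[C]_2) (v : 'cV[C]_2) : C :=
  ((map_mx conjc v)^T *m M *m v) 0 0.

Definition psd_matrix_measure Sigma : Prop :=
  (forall B, bounded_borel B -> forall v, 0 <= quadform (Sigma B) v) /\
  (forall A : nat -> set R,
     (forall n, measurable (A n : set (measurableTypeR R))) ->
     trivIset setT A -> bounded_set (\bigcup_n A n) ->
     forall i j,
       (fun n => \sum_(k < n) Re (Sigma (A k) i j)) @ \oo
         --> Re (Sigma (\bigcup_n A n) i j) /\
       (fun n => \sum_(k < n) Im (Sigma (A k) i j)) @ \oo
         --> Im (Sigma (\bigcup_n A n) i j)).

(* \int g dSigma converges and equals N.  The integral is reduced to positive
   scalar measures: v^* Sigma v extends to a Borel measure mu_v for every v,
   and v^* N v = \int g dmu_v for all v determines N by polarization. *)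
Definition mx_integral Sigma (g : R -> C) (N : 'M[C]_2) : Prop :=
  forall v : 'cV[C]_2,
    exists mu : {measure set (measurableTypeR R) -> \bar R},
      [/\ forall B, bounded_borel B -> mu B = (Re (quadform (Sigma B) v))%:E,
          cintegrable mu setT g &
          quadform N v = cintegral mu setT g].

Definition herglotz_kernel (z : C) (t : R) : C :=
  (t%:C - z)^-1 - (t / (1 + t ^+ 2))%:C.

Definition is_spectral_measure (q : R -> C) (alpha : option C) Sigma : Prop :=
  [/\ psd_matrix_measure Sigma,
      exists N, mx_integral Sigma (fun t => ((1 + t ^+ 2)^-1)%:C) N &
      exists M : C -> 'M[C]_2,
        forall z : C, Im z != 0 ->
          is_Mfunction q alpha z (M z) /\
          mx_integral Sigma (herglotz_kernel z) (M z - Remx (M (0 +i* 1)))].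

(* dSigma = W dnu *)
Definition has_density Sigma (nu : {measure set (measurableTypeR R) -> \bar R})
    (W : R -> 'M[C]_2) : Prop :=
  forall B, bounded_borel B -> forall i j,
    cintegrable nu B (fun t => W t i j) /\
    Sigma B i j = cintegral nu B (fun t => W t i j).

Definition is_spectral_pair (q : R -> C) (alpha : option C)
    (nu : {measure set (measurableTypeR R) -> \bar R}) (psi : R -> C) : Prop :=
  [/\ forall B : set (measurableTypeR R), measurable B ->
        nu [set - t | t in B] = nu B,
      cmeasurable setT psi,
      ae_eq nu setT (fun t => psi (- t)) (fun t => - psi t),
      {ae nu, forall t, cabs (psi t) <= 1} &
      exists2 Sigma, is_spectral_measure q alpha Sigma &
        has_density Sigma nu (fun t => mx2 1 (psi t) (conjc (psi t)) 1)].

End matrix_measures.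

Section distinguished_solution.
Context {R : realType}.
Local Notation C := (R[i]).

(* [e'] is the continuous derivative of [e]; e is determined up to a sign. *)
Definition is_distinguished (q : R -> C) (alpha : option C) (lam : R)
    (e e' : R -> C) : Prop :=
  [/\ exists e'', [/\ primitive e e', primitive e' e'' &
        ae_equal (fun x => - e'' x + q x * e x) (fun x => lam%:C * conjc (e x))],
      bc alpha (e 0) (e' 0),
      L2 e &
      L2norm e = 1].

Definition ell (alpha : option C) (e0 e0' : C) : C :=
  if alpha is Some a then (conjc a * e0' - e0) / japanese_bracket a else e0'.

End distinguished_solution.

(* Main.v *)
(* With s real, c complex and s^2 + |c|^2 = 1 the boundary condition is
   s f'(0) + c f(0) = 0, and (conj e, e) is an eigenvector of the hermitised
   operator for lam.  Let Y be the first column of Theta - Phi M, multiplied by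
   eta, at the point z = lam + i eta.  Lagrange's identity on the half-line gives
   ||Y||^2 = eta Im M_11(z) and <Y, (conj e, e)> = i l.  As eta -> 0, the Herglotz
   representation and dominated convergence give eta M(z) -> i Sigma({lam}); so
   Cauchy-Schwarz yields Sigma({lam})_11 >= |l|^2 / 2.  By Gronwall's inequality Y
   converges pointwise to a solution at lam satisfying the boundary condition,
   which by Fatou's lemma has squared norm at most Sigma({lam})_11.  Simplicity of
   the eigenvalue forces it to be k (conj e, e), so 2 |k|^2 <= Sigma({lam})_11,
   while its initial data give i Sigma({lam})_11 = k conj l and
   i Sigma({lam})_21 = k l.  These relations determine both entries. *)
Require Import Defs.
From mathcomp Require Import all_boot all_order all_algebra.
From mathcomp Require Import all_classical all_reals all_analysis.
From mathcomp Require Import complex.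
From mathcomp Require Import measurable_realfun ring lra.

Set Implicit Arguments.
Unset Strict Implicit.
Unset Printing Implicit Defensive.

Import Order.TTheory GRing.Theory Num.Theory.
Import numFieldNormedType.Exports.

Local Open Scope classical_set_scope.
Local Open Scope ring_scope.
Local Open Scope complex_scope.

Local Notation Re := complex.Re.
Local Notation Im := complex.Im.

(** * Primitives of locally integrable functions *)

(** That the atom at [lam] is given by the boundary data of the eigenfunction is usually read off an
    eigenfunction expansion. None is used here: [Sigma({lam})] is squeezed between two estimates
    with the same value. The lower one needs only that (conj e, e) has squared norm 2; simplicity
    enters the upper one, because the limit of Y must be a multiple of (conj e, e) before its norm
    can be compared with its initial data. The density of [Sigma] has first column (1, conj psi), so
    the first column of [Sigma({lam})] contains nu({lam}) and conj psi(lam) nu({lam}). This is why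
    only the first column of M is followed. Three obstacles shape the rest. The potential is merely
    measurable, so solutions are handled through integral equations, and the solution at [lam] is
    built as a Cauchy limit of the Y. Simplicity concerns |H|, known only as a nonnegative
    self-adjoint square root of H^* H, so solutions of the system must be turned into eigenvectors
    of |H|. Finally, an integral against [Sigma] provides a scalar measure that may depend on the
    integrand; these measures have to be identified before dominated convergence applies. *)

Lemma integrable_ext d (T : measurableType d) (R : realType)
    (mu : {measure set T -> \bar R}) (D : set T) (f g : T -> \bar R) :
  measurable D -> (forall x, D x -> f x = g x) ->
  mu.-integrable D f -> mu.-integrable D g.
Proof.
by move=> mD fg If; apply: (eq_integrable mD f) If => x /set_mem; exact: fg.
Qed.

Section real_primitives.
Context {R : realType}.
Local Notation leb := (@lebesgue_measure R).
Implicit Types (f g h : R -> R) (a b x y : R).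

Definition loc_integrable g := forall x, 0 <= x -> leb.-integrable `[0, x] (EFin \o g).

(** Local absolute continuity in integrated form. Differentiation almost everywhere is never
    invoked: the product rule, limits and uniqueness are all derived from this integral equation. *)
Definition real_primitive f g := forall x, 0 <= x ->
  leb.-integrable `[0, x] (EFin \o g) /\ f x = f 0 + \int[leb]_(t in `[0, x]) g t.

Lemma real_primitive_loc f g : real_primitive f g -> loc_integrable g.
Proof. by move=> fg x /fg[]. Qed.

Lemma loc_integrableD f g : loc_integrable f -> loc_integrable g ->
  loc_integrable (f \+ g).
Proof. by move=> lf lg x x0; exact: (integrableD _ (lf x x0) (lg x x0)). Qed.

Lemma loc_integrableZ f (k : R) : loc_integrable f -> loc_integrable (fun x => k * f x).
Proof. by move=> lf x x0; exact: (integrableZl _ k (lf x x0)). Qed.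

Lemma loc_integrable_norm f : loc_integrable f -> loc_integrable (fun x => `|f x|).
Proof. by move=> lf x x0; exact: (integrable_norm (lf x x0)). Qed.

Lemma real_primitiveD f g f' g' : real_primitive f f' -> real_primitive g g' ->
  real_primitive (f \+ g) (f' \+ g').
Proof.
move=> ff gg x x0; have [If Ef] := ff x x0; have [Ig Eg] := gg x x0; split.
  exact: (integrableD _ If Ig).
by rewrite RintegralD//= Ef Eg; ring.
Qed.

Lemma real_primitiveZ f f' (k : R) : real_primitive f f' ->
  real_primitive (fun x => k * f x) (fun x => k * f' x).
Proof.
move=> ff x x0; have [If Ef] := ff x x0; split.
  exact: (integrableZl _ k If).
by rewrite RintegralZl//= Ef; ring.
Qed.

Lemma real_primitiveN f f' : real_primitive f f' -> real_primitive (\- f) (\- f').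
Proof.
move=> ff; have := real_primitiveZ (-1) ff.
by congr real_primitive; apply/funext => x /=; rewrite mulN1r.
Qed.

Lemma real_primitiveB f g f' g' : real_primitive f f' -> real_primitive g g' ->
  real_primitive (f \- g) (f' \- g').
Proof. by move=> ff /real_primitiveN; exact: real_primitiveD. Qed.

Lemma loc_integrable_cst (k : R) : loc_integrable (cst k).
Proof.
move=> x x0; apply: continuous_compact_integrable; first exact: segment_compact.
by apply: continuous_subspaceT => t; exact: cvg_cst.
Qed.

Lemma integrable_oc g x y : loc_integrable g -> 0 <= x -> x <= y ->
  leb.-integrable `]x, y] (EFin \o g).
Proof.
move=> lg x0 xy; apply: integrableS (lg y (le_trans x0 xy)) => //.
by apply: subset_itvr; rewrite bnd_simp.
Qed.

Lemma integral_itvB g x y : loc_integrable g -> 0 <= x -> x <= y ->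
  \int[leb]_(t in `[0, y]) g t - \int[leb]_(t in `[0, x]) g t =
  \int[leb]_(t in `]x, y]) g t.
Proof.
move=> lg x0 xy; apply: Rintegral_itvB; rewrite ?bnd_simp//.
by apply: lg; exact: le_trans xy.
Qed.

Lemma real_primitiveB_itv f g x y : real_primitive f g -> 0 <= x -> x <= y ->
  f y - f x = \int[leb]_(t in `]x, y]) g t.
Proof.
move=> fg x0 xy; rewrite -integral_itvB//; last exact: real_primitive_loc fg.
have [_ ->] := fg x x0; have [_ ->] := fg y (le_trans x0 xy); ring.
Qed.

Lemma real_primitive_bounded f g b : real_primitive f g -> 0 <= b ->
  exists2 M, 0 <= M & forall x, x \in `[0, b] -> `|f x| <= M.
Proof.
move=> fg b0; have lg := real_primitive_loc fg.
exists (`|f 0| + \int[leb]_(t in `[0, b]) `|g t|).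
  by apply: addr_ge0 => //; apply: Rintegral_ge0.
move=> x; rewrite in_itv/= => /andP[x0 xb].
have [Ig ->] := fg x x0.
apply: (le_trans (ler_normD _ _)); apply: lerD => //.
apply: (le_trans (le_normr_Rintegral _ _)) => //.
rewrite -subr_ge0 integral_itvB//; last exact: loc_integrable_norm.
by apply: Rintegral_ge0.
Qed.

(** This is absolute continuity of the integral of |g|, used on the set ]x, y] of measure below [d].
    Since that result concerns functions integrable on the whole line, [g] is cut off outside
    [0, b]. *)
Lemma real_primitive_unif f g b (e : R) : real_primitive f g -> 0 <= b -> 0 < e ->
  exists2 d, 0 < d & forall x y, 0 <= x -> x <= y -> y <= b -> y - x < d ->
    `|f y - f x| <= e.
Proof.
move=> fg b0 e0; have lg := real_primitive_loc fg.
pose gb := g \_ `[0, b].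
have [d [d0 H]] : exists d : R, 0 < d /\
    forall A, measurable A -> (leb A < d%:E)%E -> \int[leb]_(x in A) `|gb x| < e.
  apply: integral_normr_continuous => //=.
  rewrite -restrict_EFin; apply/integrable_restrict => //=; rewrite setTI.
  exact: lg.
exists d => // x y x0 xy yb yxd.
rewrite (real_primitiveB_itv fg)//.
apply: (le_trans (le_normr_Rintegral _ _)) => //; first exact: integrable_oc.
rewrite [leLHS](_ : _ = (\int[leb]_(t in `]x, y]) `|gb t|))//; last first.
  apply: eq_Rintegral => //= z; rewrite inE/= in_itv/= => /andP[xz zy].
  by rewrite /gb patchE ifT// inE/= in_itv/= (le_trans x0 (ltW xz)) (le_trans zy).
apply/ltW/H => //; rewrite lebesgue_measure_itv/= lte_fin.
by case: ifPn => _; rewrite -?EFinD lte_fin.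
Qed.

Lemma real_primitive_continuous f g b : real_primitive f g -> 0 <= b ->
  {within `[0, b], continuous f}.
Proof.
move=> fg b0.
have lg := real_primitive_loc fg.
have H : {within `[0, b], continuous (fun x => f 0 + parameterized_integral leb 0 x g)}.
  have := @parameterized_integral_continuous R 0 b g b0 (lg b b0).
  move=> h x; apply: cvgD; [exact: cvg_cst|exact: h].
apply: subspace_eq_continuous H => x /set_mem /=; rewrite in_itv/= => /andP[x0 _].
by have [_ E] := fg x x0; rewrite [RHS]E.
Qed.

Lemma real_primitive_measurable f g b : real_primitive f g -> 0 <= b ->
  measurable_fun `[0, b] f.
Proof.
move=> fg b0; apply: subspace_continuous_measurable_fun => //.
exact: real_primitive_continuous fg b0.
Qed.

Lemma measurable_half_line f : (forall b, 0 <= b -> measurable_fun `[0, b] f) ->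
  measurable_fun (Rplus : set R) f.
Proof.
move=> mf; have m : measurable_fun (\bigcup_n `[0, n%:R : R]%classic) f.
  by apply/measurable_fun_bigcup => // n; exact: mf.
apply: measurable_funS m; first exact: bigcup_measurable.
move=> x /=; rewrite /Rplus /= in_itv/= andbT => x0.
exists (Num.truncn x).+1 => //=; rewrite in_itv/= (ltW x0)/=.
exact/ltW/Num.Theory.truncnS_gt.
Qed.

Lemma loc_integrableM f f' g : real_primitive f f' -> loc_integrable g ->
  loc_integrable (f \* g).
Proof.
move=> fg lg x x0.
have [M M0 HM] := real_primitive_bounded fg x0.
have := @integrableMr _ _ R leb `[0, x] (measurable_itv _) f (EFin \o g).
apply => //.
- exact: real_primitive_measurable fg x0.
- exists M; split; first exact: num_real.
  move=> z Mz t /= tx; apply: (le_trans (HM t _) (ltW Mz)).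
  exact: tx.
- exact: lg.
Qed.

Lemma loc_integrable_primitive f f' : real_primitive f f' -> loc_integrable f.
Proof.
move=> ff x x0.
have [M M0 HM] := real_primitive_bounded ff x0.
apply: measurable_bounded_integrable => //.
- rewrite /= lebesgue_measure_itv/= lte_fin; case: ifP => _ //.
  by rewrite -EFinD ltry.
- exact: real_primitive_measurable ff x0.
- exists M; split; first exact: num_real.
  by move=> z Mz t /= tx; apply: (le_trans (HM t tx) (ltW Mz)).
Qed.

(* Chaining over a uniform subdivision of [[0, b]]. *)
Lemma chain_le (D L : R -> R) b (d : R) : 0 <= b -> 0 < d ->
  (forall x y, 0 <= x -> x <= y -> y <= b -> y - x < d ->
    `|D y - D x| <= L y - L x) ->
  `|D b - D 0| <= L b - L 0.
Proof.
move=> b0 d0 H.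
(* The successor makes [n] positive and larger than [b / d], so that the mesh [b / n] is below
   [d]. *)
pose n := (Num.truncn (b / d)).+1.
have n0 : 0 < n%:R :> R by rewrite ltr0n.
have bn : b / n%:R < d.
  by rewrite ltr_pdivrMr// mulrC -ltr_pdivrMr//; exact: Num.Theory.truncnS_gt.
have bn0 : 0 <= b / n%:R by apply: divr_ge0 => //; exact: ltW.
suff K k : (k <= n)%N -> `|D (k%:R * (b / n%:R)) - D 0| <= L (k%:R * (b / n%:R)) - L 0.
  have := K n (leqnn n); rewrite mulrCA mulfV ?mulr1//.
  by rewrite gt_eqF.
elim: k => [_|k IH kn]; first by rewrite mul0r !subrr normr0.
have := H (k%:R * (b / n%:R)) (k.+1%:R * (b / n%:R)).
rewrite (@mulr_ge0 _ k%:R)// => /(_ isT).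
rewrite ler_wpM2r ?ler_nat// => /(_ isT).
have -> : k.+1%:R * (b / n%:R) <= b.
  by rewrite mulrA ler_pdivrMr// mulrC ler_wpM2l// ler_nat.
have -> : k.+1%:R * (b / n%:R) - k%:R * (b / n%:R) = b / n%:R.
  by rewrite -mulrBl -natr1; ring.
move=> /(_ isT bn) h1.
have h2 := IH (ltnW kn).
rewrite (_ : _ - D 0 = (D (k.+1%:R * (b / n%:R)) - D (k%:R * (b / n%:R))) +
   (D (k%:R * (b / n%:R)) - D 0)); last ring.
apply: (le_trans (ler_normD _ _)).
by apply: (le_trans (lerD h1 h2)); rewrite le_eqVlt; apply/orP; left; apply/eqP; ring.
Qed.

(** The defect [D], the product minus the integral of its expected derivative, is shown to be
    constant. By uniform continuity of [f] and [g], its increment over a short interval is at most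
    [e] times the increment of [L]; chaining gives |D b - D 0| <= e L(b) for every [e]. *)
Lemma real_primitiveM f g f' g' : real_primitive f f' -> real_primitive g g' ->
  real_primitive (f \* g) (fun x => f' x * g x + f x * g' x).
Proof.
move=> ff gg.
have lf := real_primitive_loc ff; have lg := real_primitive_loc gg.
have lfg : loc_integrable (f \* g') by exact: loc_integrableM ff lg.
have lgf : loc_integrable (fun x => f' x * g x).
  have := loc_integrableM gg lf; congr loc_integrable.
  by apply/funext => x /=; rewrite mulrC.
have lh : loc_integrable (fun x => f' x * g x + f x * g' x).
  exact: loc_integrableD lgf lfg.
move=> b b0; split; first exact: lh.
pose h x := f' x * g x + f x * g' x.
pose D x := f x * g x - \int[leb]_(t in `[0, x]) h t.
pose L x := \int[leb]_(t in `[0, x]) (`|f' t| + `|g' t|).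
have lL : loc_integrable (fun t => `|f' t| + `|g' t|).
  exact: loc_integrableD (loc_integrable_norm lf) (loc_integrable_norm lg).
have L0 : L 0 = 0 by rewrite /L set_itv1 Rintegral_set1.
have D0 : D 0 = f 0 * g 0 by rewrite /D set_itv1 Rintegral_set1 subr0.
have Lb0 : 0 <= L b by apply: Rintegral_ge0 => t _; exact: addr_ge0.
suff : forall e, 0 < e -> `|D b - D 0| <= e * L b.
  move=> H; suff : D b = D 0 by rewrite D0 /D /= -/(h) => <-; rewrite subrK.
  apply/eqP; rewrite -subr_eq0 -normr_le0; apply/ler_addgt0Pl => e e0.
  rewrite addr0.
  (* [L b] may vanish, so the tolerance is divided by [L b + 1]. *)
  have L1 : 0 < L b + 1 by exact: ltr_wpDl.
  apply: (le_trans (H (e / (L b + 1)) _)); first exact: divr_gt0.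
  rewrite mulrAC ler_pdivrMr//; apply: ler_wpM2l; first exact: ltW.
  by rewrite lerDl.
move=> e e0.
have [d1 d10 H1] := real_primitive_unif ff b0 e0.
have [d2 d20 H2] := real_primitive_unif gg b0 e0.
have := @chain_le D (fun x => e * L x) b (Num.min d1 d2) b0.
rewrite L0 mulr0 subr0; apply; first by rewrite lt_min d10.
move=> x y x0 xy yb; rewrite lt_min => /andP[yx1 yx2].
have y0 := le_trans x0 xy.
have If' := integrable_oc lf x0 xy; have Ig' := integrable_oc lg x0 xy.
have Ih := integrable_oc lh x0 xy.
have IL := integrable_oc lL x0 xy.
have I1 : leb.-integrable `]x, y] (EFin \o (fun t => g y * f' t + f x * g' t)).
  exact: (integrableD _ (integrableZl _ (g y) If') (integrableZl _ (f x) Ig')).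
(* The product increment splits as g(y) (f(y) - f(x)) + f(x) (g(y) - g(x)). Written as integrals
   over ]x, y], it leaves only small differences of [f] and [g] once f' g + f g' is subtracted. *)
have -> : D y - D x = \int[leb]_(t in `]x, y]) (f' t * (g y - g t) + (f x - f t) * g' t).
  transitivity ((g y * (f y - f x) + f x * (g y - g x)) -
    (\int[leb]_(t in `[0, y]) h t - \int[leb]_(t in `[0, x]) h t)).
    by rewrite /D; ring.
  rewrite integral_itvB// (real_primitiveB_itv ff)// (real_primitiveB_itv gg)//.
  rewrite -[g y * _]RintegralZl// -[f x * _]RintegralZl//.
  rewrite -RintegralD//; [|exact: (integrableZl _ (g y) If')|exact: (integrableZl _ (f x) Ig')].
  rewrite -RintegralB//.
  by apply: eq_Rintegral => t _; rewrite /h; ring.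
have I2 : leb.-integrable `]x, y]
    (EFin \o (fun t => f' t * (g y - g t) + (f x - f t) * g' t)).
  apply: (integrable_ext _ _ (integrableB _ I1 Ih)) => //.
  by move=> t _ /=; rewrite -EFinB; congr EFin; rewrite /h; ring.
apply: (le_trans (le_normr_Rintegral _ _)) => //.
rewrite -mulrBr /L integral_itvB// -RintegralZl//.
apply: le_Rintegral => //.
- exact: integrable_norm I2.
- exact: (integrableZl _ e IL).
move=> t /=; rewrite in_itv/= => /andP[xt ty].
have t0 : 0 <= t by apply: (le_trans x0); exact: ltW.
apply: (le_trans (ler_normD _ _)); rewrite !normrM mulrDr.
apply: lerD.
  rewrite mulrC; apply: ler_wpM2r => //; apply: H2 => //.
  by apply: le_lt_trans yx2; rewrite lerB// ltW.
apply: ler_wpM2r => //; rewrite distrC; apply: H1 => //; first exact: ltW.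
  exact: le_trans yb.
by apply: le_lt_trans yx1; rewrite lerB.
Qed.

End real_primitives.

(** * Gronwall's inequality, uniqueness of derivatives and limits of primitives *)

Section gronwall.
Context {R : realType}.
Local Notation leb := (@lebesgue_measure R).
Implicit Types (f g h : R -> R) (a b x y : R).

Lemma real_primitive_expR (k : R) :
  real_primitive (fun x => expR (k * x)) (fun x => k * expR (k * x)).
Proof.
have cE : continuous (fun x : R => expR (k * x)).
  move=> x; apply: continuous_comp; last exact: continuous_expR.
  exact: mulrl_continuous.
have cf : continuous (fun x : R => k * expR (k * x)).
  by move=> x; apply: cvgM; [exact: cvg_cst|exact: cE].
have dE x : is_derive x 1 (fun x => expR (k * x)) (k * expR (k * x)).
  have H : is_derive x 1 (fun x : R => k * x) k.
    by apply: is_derive_eq; rewrite [k *: _]mulr1.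
  rewrite mulrC; exact: (is_derive1_comp (is_derive_expR (k * x)) H).
move=> x x0; split.
  apply: continuous_compact_integrable; first exact: segment_compact.
  exact: continuous_subspaceT.
have [->|xn0] := eqVneq x 0; first by rewrite set_itv1 Rintegral_set1 addr0.
have x0' : 0 < x by rewrite lt_neqAle eq_sym xn0.
rewrite /Rintegral (@continuous_FTC2 _ _ (fun x => expR (k * x)))//=.
- by rewrite mulr0 subrKC.
- exact: continuous_subspaceT.
- split.
  + by move=> y _; have [] := dE y.
  + exact/cvg_at_right_filter/cE.
  + exact/cvg_at_left_filter/cE.
- by move=> y _; rewrite derive1E; have [_ ->] := dE y.
Qed.

(** The right-hand side [F] of the assumed inequality has derivative K f <= K F, so F(x) exp(-K x)
    does not exceed its initial value [a]. *)
Lemma gronwall f a (K : R) b : loc_integrable f -> 0 <= K -> 0 <= b ->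
  (forall x, 0 <= x -> x <= b -> f x <= a + K * \int[leb]_(t in `[0, x]) f t) ->
  f b <= a * expR (K * b).
Proof.
move=> lf K0 b0 H.
pose F x := a + K * \int[leb]_(t in `[0, x]) f t.
have F0 : F 0 = a by rewrite /F set_itv1 Rintegral_set1 mulr0 addr0.
have FP : real_primitive F (fun x => K * f x).
  move=> x x0; split; first exact: loc_integrableZ lf x x0.
  by rewrite F0 RintegralZl//; exact: lf.
have EP := real_primitive_expR (- K).
have [I E] := real_primitiveM FP EP b0.
have Fb : F b * expR (- K * b) <= a.
  rewrite [leLHS]E /= F0 mulr0 expR0 mulr1 gerDl -oppr_ge0 -mulN1r -RintegralZl//.
  apply: Rintegral_ge0 => x /=; rewrite in_itv/= => /andP[x0 xb].
  rewrite (_ : _ * _ = (F x - f x) * (K * expR (- K * x))); last ring.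
  apply: mulr_ge0; first by rewrite subr_ge0 H.
  by apply: mulr_ge0 => //; exact: expR_ge0.
apply: (le_trans (H b b0 (lexx b))); rewrite -/(F b).
by move: Fb; rewrite mulNr expRN ler_pdivrMr// expR_gt0.
Qed.

(* Compare [g x] with the mean of [g], which is zero, over a short interval. *)
Lemma real_primitive_zero f g h : real_primitive f g -> real_primitive g h ->
  (forall x, 0 <= x -> f x = 0) -> forall x, 0 <= x -> g x = 0.
Proof.
move=> fg gh f0 x x0; apply/eqP; rewrite -normr_le0; apply/ler_addgt0Pl => e e0.
rewrite addr0.
have x10 : 0 <= x + 1 by apply: addr_ge0.
have [d d0 H] := real_primitive_unif gh x10 e0.
(* The minimum with 1 keeps [y] in the interval [0, x + 1] for which [d] was chosen. *)
pose y := x + Num.min (d / 2) 1.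
have m0 : 0 < Num.min (d / 2) 1 by rewrite lt_min ltr01 divr_gt0.
have xy : x < y by rewrite ltrDl.
have yx1 : y <= x + 1 by rewrite lerD2l ge_min lexx orbT.
have yxd : y - x < d.
  rewrite /y addrC addKr gt_min; apply/orP; left.
  by rewrite ltr_pdivrMr// ltr_pMr// ltr1n.
have lg := real_primitive_loc fg.
have Ig := integrable_oc lg x0 (ltW xy).
have fin : (leb `]x, y] < +oo)%E.
  by rewrite /= lebesgue_measure_itv/= lte_fin xy -EFinD ltry.
have Ic : leb.-integrable `]x, y] (EFin \o cst (g x)).
  exact: (integrable_oc (loc_integrable_cst (g x)) x0 (ltW xy)).
have muxy : fine (leb `]x, y]) = y - x.
  by rewrite /= lebesgue_measure_itv/= lte_fin xy -EFinD.
have E : g x * (y - x) = \int[leb]_(t in `]x, y]) (g x - g t).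
  rewrite RintegralB// Rintegral_cst// -(real_primitiveB_itv fg x0 (ltW xy)).
  by rewrite !f0 ?(le_trans x0 (ltW xy))// subrr subr0 muxy.
have yx0 : 0 < y - x by rewrite subr_gt0.
rewrite -(ler_pM2r yx0) -[in leLHS](gtr0_norm yx0) -normrM E.
apply: (le_trans (le_normr_Rintegral _ _)) => //.
  exact: (integrableB _ Ic Ig).
rewrite -muxy -Rintegral_cst//; apply: le_Rintegral => //.
- exact/integrable_norm/(integrableB _ Ic Ig).
- exact: (integrable_oc (loc_integrable_cst e) x0 (ltW xy)).
move=> t /=; rewrite in_itv/= => /andP[xt ty].
rewrite distrC; apply: H => //; first exact: ltW.
  exact: le_trans yx1.
by apply: le_lt_trans yxd; rewrite lerB.
Qed.

(** Dominated convergence on each [0, x], with the constant [B x] as dominating function, passes to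
    the limit in the integral equation. *)
Lemma real_primitive_lim (f_ g_ : nat -> R -> R) f g (B : R -> R) :
  (forall n, real_primitive (f_ n) (g_ n)) ->
  (forall x, 0 <= x -> f_ n x @[n --> \oo] --> f x) ->
  (forall x, 0 <= x -> g_ n x @[n --> \oo] --> g x) ->
  (forall b n x, 0 <= x -> x <= b -> `|g_ n x| <= B b) ->
  real_primitive f g.
Proof.
move=> fg cf cg gB x x0.
have [] := @dominated_convergence _ _ R leb `[0, x] (measurable_itv _)
  (fun n => EFin \o g_ n) (EFin \o g) (EFin \o cst (B x)).
- by move=> n; have [I _] := fg n x x0; exact: measurable_int I.
- apply: emeasurable_fun_cvg => [n|t].
    by have [I _] := fg n x x0; exact: measurable_int I.
  rewrite /= in_itv/= => /andP[t0 _].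
  by apply/fine_cvgP; split; [exact: nearW|exact: cg].
- apply: aeW => t; rewrite /= in_itv/= => /andP[t0 _].
  by apply/fine_cvgP; split; [exact: nearW|exact: cg].
- exact: loc_integrable_cst.
- apply: aeW => t n /=; rewrite in_itv/= => /andP[t0 tx].
  by rewrite lee_fin; exact: gB.
move=> Ig _ cI; split => //.
have cI' : \int[leb]_(t in `[0, x]) g_ n t @[n --> \oo] -->
    \int[leb]_(t in `[0, x]) g t.
  apply: fine_cvg; rewrite fineK; first exact: cI.
  exact: integrable_fin_num Ig.
have c1 : f_ n x @[n --> \oo] --> f 0 + \int[leb]_(t in `[0, x]) g t.
  have -> : (fun n => f_ n x) = (fun n => f_ n 0 + \int[leb]_(t in `[0, x]) g_ n t).
    by apply/funext => n; have [_ ->] := fg n x x0.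
  by apply: cvgD cI'; exact: cf.
by rewrite -(cvg_lim _ c1)// -(cvg_lim _ (cf x x0)).
Qed.

End gronwall.

(** * The half-line *)

Section half_line.
Context {R : realType}.
Local Notation leb := (@lebesgue_measure R).
Local Notation Rplus := (@Rplus R).
Implicit Types (f g h u v : R -> R) (a b x y : R).

Lemma measurable_Rplus : measurable (Rplus : set (measurableTypeR R)).
Proof. exact: measurable_itv. Qed.
Hint Resolve measurable_Rplus : core.

(** [Rplus] is open at 0 whereas primitives are integrated from a closed end; the single point 0 is
    null. *)
Lemma integrable_cy g : leb.-integrable Rplus (EFin \o g) ->
  leb.-integrable `[0, +oo[ (EFin \o g).
Proof.
move=> /integrableP[/measurable_EFinP mg Ig].
have mg' : measurable_fun `[(0 : R), +oo[ g.
  by apply/measurable_fun_itv_obnd_cbndP.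
apply/integrableP; split; first exact/measurable_EFinP.
rewrite -integral_itv_obnd_cbnd//.
by apply: measurableT_comp => //; exact/measurable_EFinP.
Qed.

Lemma integrable_loc g : leb.-integrable Rplus (EFin \o g) -> loc_integrable g.
Proof.
move=> /integrable_cy Ig x x0; apply: integrableS Ig => //.
by apply: subset_itvl; rewrite bnd_simp.
Qed.

Lemma measurable_cy g : measurable_fun Rplus g -> measurable_fun `[(0 : R), +oo[ g.
Proof. by move=> mg; apply/measurable_fun_itv_obnd_cbndP. Qed.

Lemma ge0_cvgn_half_line g : measurable_fun Rplus g -> (forall x, 0 <= g x) ->
  (\int[leb]_(x in `[0%R, n%:R]) (g x)%:E)%E @[n --> \oo] -->
  (\int[leb]_(x in Rplus) (g x)%:E)%E.
Proof.
move=> mg g0; have mg' := measurable_cy mg.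
(* [g] is measurable only on the half-line; cutting it off produces a function measurable on the
   whole line. *)
pose h := g \_ `[0, +oo[.
have h0 x : 0 <= h x by rewrite /h /patch; case: ifP.
have mh : measurable_fun setT h by apply/(measurable_restrictT _ _).1.
have hg x : 0 <= x -> h x = g x.
  by move=> x0; rewrite /h patchE ifT// inE /= in_itv/= x0.
have E : (\int[leb]_(x in Rplus) (g x)%:E = \int[leb]_(x in `[0%R, +oo[) (h x)%:E)%E.
  rewrite /Defs.Rplus integral_itv_obnd_cbnd; last by apply/measurable_EFinP.
  by apply: eq_integral => x /set_mem; rewrite /= in_itv/= andbT => x0; rewrite hg.
rewrite E.
have En : (fun n : nat => \int[leb]_(x in `[0%R, n%:R]) (g x)%:E)%E =
    (fun n : nat => \int[leb]_(x in `[0%R, n%:R]) (h x)%:E)%E.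
  apply/funext => n; apply: eq_integral => x /set_mem.
  by rewrite /= in_itv/= => /andP[x0 _]; rewrite hg.
rewrite En; exact: ge0_cvgn_integral.
Qed.

Lemma half_line_integrable_bounded g B : measurable_fun Rplus g ->
  (forall x, 0 <= g x) -> loc_integrable g ->
  (forall x, 0 <= x -> \int[leb]_(t in `[0, x]) g t <= B) ->
  leb.-integrable Rplus (EFin \o g).
Proof.
move=> mg g0 lg H; apply/integrableP; split; first exact/measurable_EFinP.
under eq_integral do rewrite /= ger0_norm//.
have := ge0_cvgn_half_line mg g0 => c.
apply: (@le_lt_trans _ _ B%:E); last exact: ltry.
rewrite -(cvg_lim _ c)//; apply: lime_le; first by apply/cvg_ex; eexists; exact: c.
apply: nearW => n.
by rewrite -[leLHS]fineK ?lee_fin ?H// integrable_fin_num//; exact: lg.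
Qed.

(** The tail of [g] is dominated by that of |g|. For the latter the partial integrals increase with
    x, so convergence along the integers controls every real x beyond some [N]. *)
Lemma half_line_tail g (e : R) : leb.-integrable Rplus (EFin \o g) -> 0 < e ->
  exists2 X, 0 <= X & forall x, X <= x ->
    `|\int[leb]_(t in Rplus) g t - \int[leb]_(t in `[0, x]) g t| <= e.
Proof.
move=> Ig e0.
have Ig' := integrable_cy Ig.
have In := integrable_norm Ig; have In' := integrable_cy In.
have lg := integrable_loc Ig; have ln := integrable_loc In.
have mn : measurable_fun Rplus (fun x => `|g x|).
  by apply/measurable_EFinP; exact: measurable_int In.
have c : \int[leb]_(t in `[0, n%:R]) `|g t| @[n --> \oo] -->
    \int[leb]_(t in Rplus) `|g t|.
  apply: fine_cvg; rewrite fineK; first exact: ge0_cvgn_half_line.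
  exact: integrable_fin_num In.
move/cvgrPdist_le : c => /(_ e e0)[N _ HN].
exists N%:R => // x Nx.
have x0 : 0 <= x by exact: le_trans Nx.
have conv h : leb.-integrable Rplus (EFin \o h) ->
    \int[leb]_(t in Rplus) h t - \int[leb]_(t in `[0, x]) h t =
    \int[leb]_(t in `]x, +oo[) h t.
  move=> Ih; rewrite /Defs.Rplus (Rintegral_itv_obnd_cbnd (r := 0))//.
  by apply: (Rintegral_itvB (integrable_cy Ih)); rewrite bnd_simp.
rewrite conv//; apply: (le_trans (le_normr_Rintegral _ _)) => //.
  by apply: integrableS Ig' => //; apply: subset_itvr; rewrite bnd_simp.
rewrite -conv//; apply: le_trans (HN N _) => //=.
apply: le_trans (ler_norm _); rewrite lerB//.
rewrite -subr_ge0 integral_itvB//.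
by apply: Rintegral_ge0.
Qed.

(** If c were nonzero, |f| would exceed |c|/2 far out and an interval of length 6/|c| would carry
    mass 3. Beyond [Y] all partial integrals of |f| lie within 1 of the total, so they differ by at
    most 2. *)
Lemma integrable_limit_zero f (c : R) : leb.-integrable Rplus (EFin \o f) ->
  (forall e, 0 < e -> exists2 X, 0 <= X & forall x, X <= x -> `|f x - c| <= e) ->
  c = 0.
Proof.
move=> If H; apply/eqP; apply: contraT => c0.
have nc0 : 0 < `|c| by rewrite normr_gt0.
have [X X0 HX] := H (`|c| / 2) (divr_gt0 nc0 (ltr0Sn _ _)).
have If' := integrable_norm If.
have li := integrable_loc If'.
have [Y Y0 HY] := half_line_tail If' (@ltr01 R).
pose Z := Num.max X Y.
have XZ : X <= Z by rewrite le_max lexx.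
have Z0 : 0 <= Z by exact: le_trans XZ.
pose W := Z + 2 * 3 / `|c|.
have ZW : Z <= W by rewrite lerDl; apply: divr_ge0 => //.
have h1 := HY Z; have h2 := HY W.
have YZ : Y <= Z by rewrite le_max lexx orbT.
have {}h1 := h1 YZ; have {}h2 := h2 (le_trans YZ ZW).
have E := integral_itvB li Z0 ZW.
have L : 3 <= \int[leb]_(t in `]Z, W]) `|f t|.
  have -> : 3 = \int[leb]_(t in `]Z, W]) (`|c| / 2).
    rewrite Rintegral_cst//= lebesgue_measure_itv/= lte_fin.
    have -> : Z < W by rewrite ltrDl divr_gt0.
    rewrite -EFinD /= /W addrC addKr; field; exact: lt0r_neq0.
  apply: le_Rintegral => //.
  - exact: (integrable_oc (loc_integrable_cst _) Z0 ZW).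
  - exact: (integrable_oc li Z0 ZW).
  move=> t /=; rewrite in_itv/= => /andP[Zt tW].
  have := HX t (le_trans XZ (ltW Zt)).
  have := ler_distD (f t) c 0; rewrite !subr0 distrC; lra.
move: h1 h2 E L; rewrite !ler_norml => /andP[a1 a2] /andP[a3 a4]; lra.
Qed.

(** * Square-integrable functions and Lagrange's identity on the half-line *)

Definition real_L2 f :=
  measurable_fun Rplus f /\ leb.-integrable Rplus (EFin \o (fun x => f x ^+ 2)).

Lemma real_L2M f g : real_L2 f -> real_L2 g ->
  leb.-integrable Rplus (EFin \o (fun x => f x * g x)).
Proof.
move=> [mf If] [mg Ig].
apply: le_integrable (integrableD _ If Ig) => //.
  by apply/measurable_EFinP; exact: measurable_funM.
move=> x _; rewrite /= lee_fin.
rewrite [leRHS]ger0_norm ?addr_ge0 ?sqr_ge0//.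
rewrite ler_norml; apply/andP; split.
  by have := sqr_ge0 (f x + g x); have := sqr_ge0 (f x); have := sqr_ge0 (g x); nra.
by have := sqr_ge0 (f x - g x); have := sqr_ge0 (f x); have := sqr_ge0 (g x); nra.
Qed.

Lemma real_L2D f g : real_L2 f -> real_L2 g -> real_L2 (f \+ g).
Proof.
move=> Lf Lg; have [mf If] := Lf; have [mg Ig] := Lg; split.
  exact: measurable_funD.
have I2 := real_L2M Lf Lg.
have := integrableD measurable_Rplus (integrableD measurable_Rplus If Ig)
  (integrableZl measurable_Rplus 2 I2).
by apply: integrable_ext => // x _ /=; congr EFin; ring.
Qed.

Lemma real_L2_bounded f h (K : R) : real_L2 f -> measurable_fun Rplus h ->
  (forall x, `|h x| <= K) -> real_L2 (fun x => h x * f x).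
Proof.
move=> [mf If] mh hK; split; first exact: measurable_funM.
have := integrableZl measurable_Rplus (K ^+ 2) If.
apply: le_integrable => //.
  by apply/measurable_EFinP; apply: measurable_funX; exact: measurable_funM.
move=> x _; rewrite /= lee_fin [leLHS]ger0_norm ?sqr_ge0// [leRHS]ger0_norm; last first.
  by apply: mulr_ge0; exact: sqr_ge0.
rewrite exprMn; apply: ler_wpM2r; first exact: sqr_ge0.
have K0 : 0 <= K by apply: le_trans (hK 0).
by rewrite -[leLHS]real_normK ?num_real// ler_sqr ?nnegrE.
Qed.

Lemma real_L2Z f (k : R) : real_L2 f -> real_L2 (fun x => k * f x).
Proof. by move=> Lf; apply: (@real_L2_bounded f (cst k) `|k|). Qed.

Lemma real_L2N f : real_L2 f -> real_L2 (\- f).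
Proof.
move=> /(real_L2Z (-1)); congr real_L2.
by apply/funext => x /=; rewrite mulN1r.
Qed.

Lemma real_L2B f g : real_L2 f -> real_L2 g -> real_L2 (f \- g).
Proof. by move=> Lf /real_L2N; exact: real_L2D. Qed.

(* If [\int u'^2] diverged, then [u u' = u u' (0) + \int (u'^2 + u u'')] would
   tend to infinity, hence so would [u^2]. *)
Lemma real_L2_derivative u u' u'' : real_primitive u u' -> real_primitive u' u'' ->
  real_L2 u -> real_L2 u'' -> real_L2 u'.
Proof.
move=> uu uu' Lu Lu''.
have mu' : measurable_fun Rplus u'.
  by apply: measurable_half_line => b; exact: (real_primitive_measurable uu').
split => //.
have P1 := real_primitiveM uu uu'.
have P2 := real_primitiveM uu uu.
have Iuu := real_L2M Lu Lu''.
have luu := integrable_loc Iuu.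
have lu2 : loc_integrable (fun x => u' x ^+ 2).
  exact: loc_integrableM uu' (loc_integrable_primitive uu').
pose C := \int[leb]_(t in Rplus) `|u t * u'' t|.
have HC x : 0 <= x -> `|\int[leb]_(t in `[0, x]) (u t * u'' t)| <= C.
  move=> x0; apply: (le_trans (le_normr_Rintegral _ _)) => //; first exact: luu.
  have In := integrable_norm Iuu.
  rewrite /C /Defs.Rplus (Rintegral_itv_obnd_cbnd (r := 0))//.
  rewrite -subr_ge0 Rintegral_itvB//; last exact: integrable_cy.
  by apply: Rintegral_ge0.
(* With this bound, exceeding [B] at [X] forces u u' >= 1 from [X] on: [C] absorbs the integral of u
   u'' and the last term the initial value. *)
pose B := 1 + C + `|u 0 * u' 0|.
apply: (@half_line_integrable_bounded _ B) => //.
- exact: measurable_funX.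
- by move=> x; exact: sqr_ge0.
move=> X X0; rewrite leNgt; apply/negP => HX.
have big x : X <= x -> 1 <= u x * u' x.
  move=> Xx; have x0 := le_trans X0 Xx.
  have [_ /= ->] := P1 x x0.
  have -> : \int[leb]_(t in `[0, x]) (u' t * u' t + u t * u'' t) =
      \int[leb]_(t in `[0, x]) (u' t ^+ 2) + \int[leb]_(t in `[0, x]) (u t * u'' t).
    by rewrite RintegralD//; [exact: lu2|exact: luu].
  have h1 := HC x x0.
  have : 0 <= \int[leb]_(t in `[0, x]) (u' t ^+ 2) - \int[leb]_(t in `[0, X]) (u' t ^+ 2).
    by rewrite integral_itvB//; apply: Rintegral_ge0 => t _; exact: sqr_ge0.
  move: HX h1; rewrite /B ler_norml => HX /andP[h1 _].
  have := ler_norm (- (u 0 * u' 0)); rewrite normrN; lra.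
(* The derivative 2 u u' of u^2 is at least 2 beyond [X], and one unit of length suffices. *)
have big2 x : X + 1 <= x -> 1 <= u x ^+ 2.
  move=> Xx.
  have X1 : X <= X + 1 by rewrite lerDl.
  have Xlx := le_trans X1 Xx.
  have := real_primitiveB_itv P2 X0 Xlx.
  have -> : \int[leb]_(t in `]X, x]) (u' t * u t + u t * u' t) =
    \int[leb]_(t in `]X, x]) (2 * (u t * u' t)).
    by apply: eq_Rintegral => t _; ring.
  have l2 : loc_integrable (fun t => 2 * (u t * u' t)).
    by apply: loc_integrableZ; exact: loc_integrableM uu (loc_integrable_primitive uu').
  have : 2 * (x - X) <= \int[leb]_(t in `]X, x]) (2 * (u t * u' t)).
    have -> : 2 * (x - X) = \int[leb]_(t in `]X, x]) 2.
      rewrite Rintegral_cst//= lebesgue_measure_itv/= lte_fin.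
      by rewrite (lt_le_trans _ Xx) ?ltrDl// -EFinD.
    apply: le_Rintegral => //.
    - exact: (integrable_oc (loc_integrable_cst _) X0 Xlx).
    - exact: (integrable_oc l2 X0 Xlx).
    move=> t /=; rewrite in_itv/= => /andP[Xt _].
    by have := big t (ltW Xt); lra.
  have := sqr_ge0 (u X); rewrite /= -!expr2; lra.
have [_ Iu2] := Lu.
have [Y Y0 HY] := half_line_tail Iu2 (@ltr01 R).
pose Z := Num.max (X + 1) Y.
have XZ : X + 1 <= Z by rewrite le_max lexx.
have YZ : Y <= Z by rewrite le_max lexx orbT.
have Z0 : 0 <= Z by exact: le_trans YZ.
have ZW : Z <= Z + 3 by rewrite lerDl.
have l2 := integrable_loc Iu2.
(* Mass 3 on one interval is too much: the two partial integrals of u^2 lie within 1 of the same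
   total. *)
have : 3 <= \int[leb]_(t in `]Z, Z + 3]) (u t ^+ 2).
  have E3 : \int[leb]_(t in `]Z, Z + 3]) (1 : R) = 3.
    rewrite Rintegral_cst//= lebesgue_measure_itv/= lte_fin ltrDl ltr0n/=.
    by rewrite /= addrC addKr mul1r.
  rewrite -[leLHS]E3; apply: le_Rintegral => //.
  - exact: (integrable_oc (loc_integrable_cst _) Z0 ZW).
  - exact: (integrable_oc l2 Z0 ZW).
  by move=> t /=; rewrite in_itv/= => /andP[Zt _]; apply: big2; apply/ltW/(le_lt_trans XZ).
rewrite -integral_itvB//.
have := HY Z YZ; have := HY (Z + 3) (le_trans YZ ZW).
rewrite !ler_norml => /andP[? ?] /andP[? ?]; lra.
Qed.

(** The Wronskian [W] = u v' - u' v has derivative u v'' - u'' v, so it tends to W(0) plus the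
    integral. It is also integrable, as u' and v' are square-integrable too, hence that limit is
    zero. *)
Lemma real_lagrange u u' u'' v v' v'' :
  real_primitive u u' -> real_primitive u' u'' ->
  real_primitive v v' -> real_primitive v' v'' ->
  real_L2 u -> real_L2 u'' -> real_L2 v -> real_L2 v'' ->
  \int[leb]_(x in Rplus) (u x * v'' x - u'' x * v x) = u' 0 * v 0 - u 0 * v' 0.
Proof.
move=> uu uu' vv vv' Lu Lu'' Lv Lv''.
have Lu' := real_L2_derivative uu uu' Lu Lu''.
have Lv' := real_L2_derivative vv vv' Lv Lv''.
have I1 := real_L2M Lu Lv''; have I2 := real_L2M Lu'' Lv.
have Ik : leb.-integrable Rplus (EFin \o (fun x => u x * v'' x - u'' x * v x)).
  exact: (integrableB _ I1 I2).
pose W x := u x * v' x - u' x * v x.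
have PW : real_primitive W (fun x => u x * v'' x - u'' x * v x).
  have := real_primitiveB (real_primitiveM uu vv') (real_primitiveM uu' vv).
  by congr real_primitive; apply/funext => x /=; ring.
have IW : leb.-integrable Rplus (EFin \o W).
  exact: (integrableB _ (real_L2M Lu Lv') (real_L2M Lu' Lv)).
set I := Rintegral _ _ _.
suff : W 0 + I = 0 by rewrite /W; lra.
apply: (integrable_limit_zero IW) => e e0.
have [X X0 HX] := half_line_tail Ik e0.
exists X => // x Xx; have x0 := le_trans X0 Xx.
have [_ ->] := PW x x0.
rewrite opprD addrACA subrr add0r distrC; exact: HX.
Qed.

End half_line.

(** * Complex-valued functions *)

#[local] Hint Resolve measurable_Rplus : core.

Section complex_parts.
Context {R : realType}.
Local Notation C := (R[i]).
Implicit Types (z w : C) (r : R).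

Lemma complex_ext z w : Re z = Re w -> Im z = Im w -> z = w.
Proof. by case: z w => [a b] [c d] /= -> ->. Qed.

Lemma cReD z w : Re (z + w) = Re z + Re w. Proof. by case: z w => ? ? [? ?]. Qed.
Lemma cImD z w : Im (z + w) = Im z + Im w. Proof. by case: z w => ? ? [? ?]. Qed.
Lemma cReN z : Re (- z) = - Re z. Proof. by case: z. Qed.
Lemma cImN z : Im (- z) = - Im z. Proof. by case: z. Qed.
Lemma cReM z w : Re (z * w) = Re z * Re w - Im z * Im w.
Proof. by case: z w => ? ? [? ?]. Qed.
Lemma cImM z w : Im (z * w) = Re z * Im w + Im z * Re w.
Proof. by case: z w => ? ? [? ?]. Qed.
Lemma cReJ z : Re (conjc z) = Re z. Proof. by case: z. Qed.
Lemma cImJ z : Im (conjc z) = - Im z. Proof. by case: z. Qed.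
Definition partsE := (cReD, cImD, cReN, cImN, cReM, cImM, cReJ, cImJ).

Lemma cabs2 z : cabs z ^+ 2 = Re z ^+ 2 + Im z ^+ 2.
Proof. by case: z => a b; rewrite /cabs /= sqr_sqrtr// addr_ge0 ?sqr_ge0. Qed.

Lemma mulcJ z : z * conjc z = (cabs z ^+ 2)%:C.
Proof. by rewrite cabs2; apply: complex_ext; rewrite !partsE /=; ring. Qed.

(* Used in place of the modulus: it is submultiplicative, and its integrability
   reduces to that of the real and imaginary parts. *)
Definition norm1 z : R := `|Re z| + `|Im z|.

Lemma norm1_ge0 z : 0 <= norm1 z. Proof. exact: addr_ge0. Qed.

Lemma norm1D z w : norm1 (z + w) <= norm1 z + norm1 w.
Proof.
rewrite /norm1 !partsE.
have := ler_normD (Re z) (Re w); have := ler_normD (Im z) (Im w); lra.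
Qed.

Lemma norm1N z : norm1 (- z) = norm1 z.
Proof. by rewrite /norm1 !partsE !normrN. Qed.

Lemma norm1J z : norm1 (conjc z) = norm1 z.
Proof. by rewrite /norm1 !partsE normrN. Qed.

Lemma norm1M z w : norm1 (z * w) <= norm1 z * norm1 w.
Proof.
rewrite /norm1 !partsE.
have := ler_normB (Re z * Re w) (Im z * Im w).
have := ler_normD (Re z * Im w) (Im z * Re w).
rewrite !normrM; lra.
Qed.

Lemma Re_le_norm1 z : `|Re z| <= norm1 z. Proof. by rewrite lerDl. Qed.
Lemma Im_le_norm1 z : `|Im z| <= norm1 z. Proof. by rewrite lerDr. Qed.

Lemma norm1_le_cabs z : norm1 z <= 2 * cabs z.
Proof.
have h : 0 <= cabs z by case: z => a b; exact: sqrtr_ge0.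
have := cabs2 z; rewrite /norm1 => E.
have hr : `|Re z| <= cabs z.
  rewrite -ler_sqr ?nnegrE// real_normK ?num_real// E lerDl; exact: sqr_ge0.
have hi : `|Im z| <= cabs z.
  rewrite -ler_sqr ?nnegrE// real_normK ?num_real// E lerDr; exact: sqr_ge0.
lra.
Qed.

(** Taken componentwise, so that real limit theorems and real dominated convergence apply
    directly. *)
Definition ccvg (u : nat -> C) z :=
  (Re (u n) @[n --> \oo] --> Re z) /\ (Im (u n) @[n --> \oo] --> Im z).

Lemma ccvgI (a b : nat -> R) (l m : R) : a n @[n --> \oo] --> l ->
  b n @[n --> \oo] --> m -> ccvg (fun n => a n +i* b n) (l +i* m).
Proof. by []. Qed.

Lemma ccvg_cst z : ccvg (fun=> z) z.
Proof. by split; exact: cvg_cst. Qed.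

Lemma ccvgD u v z w : ccvg u z -> ccvg v w -> ccvg (fun n => u n + v n) (z + w).
Proof.
move=> [a b] [c d]; split; rewrite !partsE.
  under eq_fun do rewrite !partsE; exact: cvgD.
under eq_fun do rewrite !partsE; exact: cvgD.
Qed.

Lemma ccvgN u z : ccvg u z -> ccvg (fun n => - u n) (- z).
Proof.
move=> [a b]; split; rewrite !partsE.
  under eq_fun do rewrite !partsE; exact: cvgN.
under eq_fun do rewrite !partsE; exact: cvgN.
Qed.

Lemma ccvgB u v z w : ccvg u z -> ccvg v w -> ccvg (fun n => u n - v n) (z - w).
Proof. by move=> uz vw; apply: ccvgD => //; exact: ccvgN. Qed.

Lemma ccvgM u v z w : ccvg u z -> ccvg v w -> ccvg (fun n => u n * v n) (z * w).
Proof.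
move=> [a b] [c d]; split; rewrite !partsE.
  under eq_fun do rewrite !partsE.
  by apply: cvgB; apply: cvgM.
under eq_fun do rewrite !partsE.
by apply: cvgD; apply: cvgM.
Qed.

Lemma ccvg_unique u z w : ccvg u z -> ccvg u w -> z = w.
Proof.
move=> [a b] [c d]; apply: complex_ext.
  by rewrite -(cvg_lim _ a)// -(cvg_lim _ c).
by rewrite -(cvg_lim _ b)// -(cvg_lim _ d).
Qed.

End complex_parts.

(** * Integrals of complex-valued functions *)

Section complex_integral.
Context {R : realType}.
Local Notation C := (R[i]).
Variables (mu : {measure set (measurableTypeR R) -> \bar R}) (D : set R).
Hypothesis mD : measurable (D : set (measurableTypeR R)).
Implicit Types (f g : R -> C) (k : C).

Lemma cintegrableD f g : cintegrable mu D f -> cintegrable mu D g ->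
  cintegrable mu D (fun x => f x + g x).
Proof.
move=> [a b] [c d]; split.
  apply: (integrable_ext mD _ (integrableD mD a c)) => x _ /=.
  by rewrite partsE.
apply: (integrable_ext mD _ (integrableD mD b d)) => x _ /=.
by rewrite partsE.
Qed.

Lemma cintegrableZ f k : cintegrable mu D f -> cintegrable mu D (fun x => k * f x).
Proof.
move=> [a b]; split.
  apply: (integrable_ext mD _ (integrableB mD (integrableZl mD (Re k) a)
    (integrableZl mD (Im k) b))) => x _ /=.
  by rewrite partsE.
apply: (integrable_ext mD _ (integrableD mD (integrableZl mD (Re k) b)
  (integrableZl mD (Im k) a))) => x _ /=.
by rewrite partsE.
Qed.

Lemma cintegrableN f : cintegrable mu D f -> cintegrable mu D (fun x => - f x).
Proof.
move=> /(cintegrableZ (-1)); congr cintegrable.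
by apply/funext => x; rewrite mulN1r.
Qed.

Lemma cintegralD f g : cintegrable mu D f -> cintegrable mu D g ->
  cintegral mu D (fun x => f x + g x) = cintegral mu D f + cintegral mu D g.
Proof.
move=> [a b] [c d]; apply: complex_ext; rewrite partsE /=.
  by rewrite -RintegralD//; apply: eq_Rintegral => x _; rewrite partsE.
by rewrite -RintegralD//; apply: eq_Rintegral => x _; rewrite partsE.
Qed.

Let integrable_scale (c : R) (h : R -> R) : mu.-integrable D (EFin \o h) ->
  mu.-integrable D (EFin \o (fun x => c * h x)).
Proof. by move=> Ih; exact: (integrableZl _ c Ih). Qed.

Lemma cintegralZ f k : cintegrable mu D f ->
  cintegral mu D (fun x => k * f x) = k * cintegral mu D f.
Proof.
move=> [a b]; apply: complex_ext; rewrite partsE /=.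
  rewrite -!RintegralZl// -RintegralB//; try exact: integrable_scale.
  by apply: eq_Rintegral => x _; rewrite partsE.
rewrite -!RintegralZl// -RintegralD//; try exact: integrable_scale.
by apply: eq_Rintegral => x _; rewrite partsE.
Qed.

Lemma cintegralJ f : cintegrable mu D f ->
  cintegral mu D (fun x => conjc (f x)) = conjc (cintegral mu D f).
Proof.
move=> [a b]; apply: complex_ext; rewrite partsE /=.
  by apply: eq_Rintegral => x _; rewrite partsE.
rewrite -mulN1r -RintegralZl//; apply: eq_Rintegral => x _.
by rewrite partsE mulN1r.
Qed.

Lemma eq_cintegral f g : (forall x, D x -> f x = g x) ->
  cintegral mu D f = cintegral mu D g.
Proof.
move=> fg; rewrite /cintegral; congr Complex;
  by apply: eq_Rintegral => x /set_mem Dx; rewrite fg.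
Qed.

Lemma cintegrable_ae f g : cintegrable mu D f -> cmeasurable D g ->
  ae_eq mu D f g -> cintegrable mu D g.
Proof.
have H (a b : R -> R) : mu.-integrable D (EFin \o a) -> measurable_fun D b ->
    ae_eq mu D a b -> mu.-integrable D (EFin \o b).
  move=> /integrableP[ma Ia] mb ab.
  apply/integrableP; split; first exact/measurable_EFinP.
  suff <- : (\int[mu]_(x in D) `|(a x)%:E| = \int[mu]_(x in D) `|(b x)%:E|)%E by [].
  apply: ae_eq_integral => //.
  - exact: measurableT_comp.
  - by apply: measurableT_comp => //; exact/measurable_EFinP.
  - by apply: filterS ab => x h Dx /=; rewrite h.
move=> [a b] [c d] fg; split.
  by apply: (H (fun x => Re (f x))) => //; apply: filterS fg => x h Dx; rewrite h.
by apply: (H (fun x => Im (f x))) => //; apply: filterS fg => x h Dx; rewrite h.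
Qed.

Lemma cintegral_ae f g : cmeasurable D f -> cmeasurable D g ->
  ae_eq mu D f g -> cintegral mu D f = cintegral mu D g.
Proof.
move=> [a b] [c d] fg; rewrite /cintegral; congr Complex; congr fine.
  apply: ae_eq_integral => //; try exact/measurable_EFinP.
  by apply: filterS fg => x h Dx; rewrite h.
apply: ae_eq_integral => //; try exact/measurable_EFinP.
by apply: filterS fg => x h Dx; rewrite h.
Qed.

Lemma cintegrable_measurable f : cintegrable mu D f -> cmeasurable D f.
Proof.
move=> [a b]; split; apply/measurable_EFinP; first exact: (measurable_int mu a).
exact: (measurable_int mu b).
Qed.

End complex_integral.

(** * Complex-valued primitives *)

Section complex_primitive.
Context {R : realType}.
Local Notation C := (R[i]).
Local Notation leb := (@lebesgue_measure R).
Implicit Types (f g h u v : R -> C) (k : C).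

Lemma primitiveP f g : primitive f g <->
  real_primitive (fun x => Re (f x)) (fun x => Re (g x)) /\
  real_primitive (fun x => Im (f x)) (fun x => Im (g x)).
Proof.
split=> [H|[H1 H2] x x0].
  by split=> x x0; have [[a b] E] := H x x0; split=> //; rewrite E partsE.
have [a E1] := H1 x x0; have [b E2] := H2 x x0; split => //.
by apply: complex_ext; rewrite partsE.
Qed.

Lemma primitiveD f g f' g' : primitive f f' -> primitive g g' ->
  primitive (fun x => f x + g x) (fun x => f' x + g' x).
Proof.
move=> /primitiveP[a b] /primitiveP[c d]; apply/primitiveP; split.
  have := real_primitiveD a c.
  by congr real_primitive; apply/funext => x; rewrite partsE.
have := real_primitiveD b d.
by congr real_primitive; apply/funext => x; rewrite partsE.
Qed.

Lemma primitiveZ f f' k : primitive f f' ->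
  primitive (fun x => k * f x) (fun x => k * f' x).
Proof.
move=> /primitiveP[a b]; apply/primitiveP; split.
  have := real_primitiveB (real_primitiveZ (Re k) a) (real_primitiveZ (Im k) b).
  by congr real_primitive; apply/funext => x; rewrite partsE.
have := real_primitiveD (real_primitiveZ (Re k) b) (real_primitiveZ (Im k) a).
by congr real_primitive; apply/funext => x; rewrite partsE.
Qed.

Lemma primitiveN f f' : primitive f f' ->
  primitive (fun x => - f x) (fun x => - f' x).
Proof.
move=> /(primitiveZ (-1)).
by congr primitive; apply/funext => x; rewrite mulN1r.
Qed.

Lemma primitiveB f g f' g' : primitive f f' -> primitive g g' ->
  primitive (fun x => f x - g x) (fun x => f' x - g' x).
Proof. by move=> ff /primitiveN; exact: primitiveD. Qed.

Lemma primitiveJ f f' : primitive f f' ->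
  primitive (fun x => conjc (f x)) (fun x => conjc (f' x)).
Proof.
move=> /primitiveP[a b]; apply/primitiveP; split.
  by move: a; congr real_primitive; apply/funext => x; rewrite partsE.
have := real_primitiveN b.
by congr real_primitive; apply/funext => x; rewrite partsE.
Qed.

Lemma primitive_zero f g h : primitive f g -> primitive g h ->
  (forall x, 0 <= x -> f x = 0) -> forall x, 0 <= x -> g x = 0.
Proof.
move=> /primitiveP[a b] /primitiveP[c d] f0 x x0.
apply: complex_ext => /=.
  by apply: (real_primitive_zero a c) => // y y0; rewrite f0.
by apply: (real_primitive_zero b d) => // y y0; rewrite f0.
Qed.

Lemma primitive_cmeasurable f f' : primitive f f' -> cmeasurable (@Rplus R) f.
Proof.
move=> /primitiveP[a b]; split.
  by apply: measurable_half_line => x; exact: (real_primitive_measurable a).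
by apply: measurable_half_line => x; exact: (real_primitive_measurable b).
Qed.

Lemma Rplus_itv0 (x : R) (P : R -> Prop) :
  {ae leb, forall t : measurableTypeR R, Rplus t -> P t} ->
  {ae leb, forall t : measurableTypeR R, (`[0, x]%classic : set R) t -> P t}.
Proof.
move=> H; have H0 : {ae leb, forall t : measurableTypeR R, t <> 0}.
  exists [set 0]; split => //; first exact: lebesgue_measure_set1.
  by move=> t /= /contrapT.
apply: filterS2 H H0 => t H t0 /=; rewrite in_itv/= => /andP[t1 _].
by apply: H; rewrite /Rplus /= in_itv/= andbT lt_neqAle t1 eq_sym andbT; apply/eqP.
Qed.

Lemma cmeasurable_itv0 f (x : R) : cmeasurable Rplus f -> cmeasurable `[0, x] f.
Proof.
have H (a : R -> R) : measurable_fun Rplus a -> measurable_fun `[0, x] a.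
  move=> /measurable_cy; apply: measurable_funS => //.
  by apply: subset_itvl; rewrite bnd_simp.
by move=> [a b]; split; exact: H.
Qed.

(** This turns a differential equation that holds almost everywhere into an exact statement about
    [primitive]: the derivative may be exchanged for any Borel function in its class. *)
Lemma primitive_ae f g h : primitive f g -> cmeasurable Rplus h ->
  ae_equal g h -> primitive f h.
Proof.
move=> fg mh gh x x0; have [Ig E] := fg x x0.
have gh' := @Rplus_itv0 x _ gh.
have mh' := cmeasurable_itv0 x mh.
have mg' := cintegrable_measurable Ig.
have mI : measurable (`[0, x]%classic : set (measurableTypeR R)).
  exact: measurable_itv.
split; first exact: (cintegrable_ae mI Ig mh' gh').
by rewrite E; congr (_ + _); exact: cintegral_ae.
Qed.

(** If [f] vanishes almost everywhere, the zero function is a primitive of [f]; [primitive_zero],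
    applied one order lower, then makes [f] vanish at every point. *)
Lemma primitive_ae0 f g : primitive f g -> ae_equal f (fun=> 0) ->
  forall x, 0 <= x -> f x = 0.
Proof.
move=> fg f0.
have P0 : primitive (fun=> 0) f.
  have c0 : primitive (fun=> 0 : C) (fun=> 0 : C).
    apply/primitiveP; split=> x x0; (split; first exact: loc_integrable_cst);
    by rewrite Rintegral_cst//= mul0r addr0.
  apply: primitive_ae c0 _ _; first exact: primitive_cmeasurable fg.
  by apply: filterS f0 => x h Dx; rewrite h.
by apply: (primitive_zero P0 fg).
Qed.

End complex_primitive.

(** * Complex-valued square-integrable functions and their inner product *)

Section complex_L2.
Context {R : realType}.
Local Notation C := (R[i]).
Local Notation leb := (@lebesgue_measure R).
Implicit Types (f g h u v : R -> C) (k : C).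

Lemma L2P f : L2 f <->
  real_L2 (fun x => Re (f x)) /\ real_L2 (fun x => Im (f x)).
Proof.
split=> [[[mr mi] I]|[[mr Ir] [mi Ii]]].
  split; split => //; apply: le_integrable I => //.
  - by apply/measurable_EFinP; apply: measurable_funX.
  - by move=> x _; rewrite /= lee_fin !ger0_norm ?sqr_ge0// cabs2 lerDl sqr_ge0.
  - by apply/measurable_EFinP; apply: measurable_funX.
  - by move=> x _; rewrite /= lee_fin !ger0_norm ?sqr_ge0// cabs2 lerDr sqr_ge0.
split=> //; apply: (integrable_ext _ _ (integrableD _ Ir Ii)) => //.
by move=> x _ /=; rewrite cabs2.
Qed.

Lemma L2D f g : L2 f -> L2 g -> L2 (fun x => f x + g x).
Proof.
move=> /L2P[a b] /L2P[c d]; apply/L2P; split.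
  have := real_L2D a c.
  by congr real_L2; apply/funext => x; rewrite partsE.
have := real_L2D b d.
by congr real_L2; apply/funext => x; rewrite partsE.
Qed.

Lemma L2_bounded f h (K : R) : L2 f -> cmeasurable Rplus h ->
  (forall x, norm1 (h x) <= K) -> L2 (fun x => h x * f x).
Proof.
move=> /L2P[a b] [c d] hK; apply/L2P.
have hr x : `|Re (h x)| <= K by apply: le_trans (Re_le_norm1 _) (hK x).
have hi x : `|Im (h x)| <= K by apply: le_trans (Im_le_norm1 _) (hK x).
split.
  have := real_L2B (real_L2_bounded a c hr) (real_L2_bounded b d hi).
  by congr real_L2; apply/funext => x; rewrite partsE.
have := real_L2D (real_L2_bounded b c hr) (real_L2_bounded a d hi).
by congr real_L2; apply/funext => x; rewrite partsE.
Qed.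

Lemma L2Z f k : L2 f -> L2 (fun x => k * f x).
Proof.
by move=> Lf; apply: (@L2_bounded f (fun=> k) (norm1 k)) => //; split.
Qed.

Lemma L2N f : L2 f -> L2 (fun x => - f x).
Proof. by move=> /(L2Z (-1)); congr L2; apply/funext => x; rewrite mulN1r. Qed.

Lemma L2B f g : L2 f -> L2 g -> L2 (fun x => f x - g x).
Proof. by move=> Lf /L2N; exact: L2D. Qed.

Lemma L2J f : L2 f -> L2 (fun x => conjc (f x)).
Proof.
move=> /L2P[a b]; apply/L2P; split.
  by move: a; congr real_L2; apply/funext => x; rewrite partsE.
have := real_L2N b.
by congr real_L2; apply/funext => x; rewrite partsE.
Qed.

Lemma L2M_integrable f g : L2 f -> L2 g ->
  cintegrable leb Rplus (fun x => f x * g x).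
Proof.
move=> /L2P[a b] /L2P[c d]; split.
  apply: (integrable_ext _ _ (integrableB _ (real_L2M a c) (real_L2M b d))) => //.
  by move=> x _ /=; rewrite partsE.
apply: (integrable_ext _ _ (integrableD _ (real_L2M a d) (real_L2M b c))) => //.
by move=> x _ /=; rewrite partsE.
Qed.

Lemma L2_derivative u u' u'' : primitive u u' -> primitive u' u'' ->
  L2 u -> L2 u'' -> L2 u'.
Proof.
move=> /primitiveP[a b] /primitiveP[c d] /L2P[e f] /L2P[g h]; apply/L2P; split.
  exact: real_L2_derivative a c e g.
exact: real_L2_derivative b d f h.
Qed.

(** Stated bilinearly, without conjugation, so that its real and imaginary parts combine four
    instances of the real identity. Sesquilinear uses insert conjugated functions through
    [primitiveJ]. *)
Lemma half_line_lagrange u u' u'' v v' v'' :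
  primitive u u' -> primitive u' u'' -> primitive v v' -> primitive v' v'' ->
  L2 u -> L2 u'' -> L2 v -> L2 v'' ->
  cintegral leb Rplus (fun x => u x * v'' x - u'' x * v x) =
  u' 0 * v 0 - u 0 * v' 0.
Proof.
move=> /primitiveP[ur ui] /primitiveP[ur' ui'] /primitiveP[vr vi]
  /primitiveP[vr' vi'] /L2P[Lur Lui] /L2P[Lur' Lui'] /L2P[Lvr Lvi] /L2P[Lvr' Lvi'].
have I (a b c d : R -> R) : real_L2 a -> real_L2 b -> real_L2 c -> real_L2 d ->
    leb.-integrable Rplus (EFin \o (fun x => a x * b x - c x * d x)).
  by move=> La Lb Lc Ld; exact: (integrableB _ (real_L2M La Lb) (real_L2M Lc Ld)).
apply: complex_ext; rewrite !partsE /=.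
  rewrite [RHS](_ : _ = (Re (u' 0) * Re (v 0) - Re (u 0) * Re (v' 0)) -
     (Im (u' 0) * Im (v 0) - Im (u 0) * Im (v' 0))); last ring.
  rewrite -(real_lagrange ur ur' vr vr')// -(real_lagrange ui ui' vi vi')//.
  rewrite -RintegralB//; try exact: I.
  by apply: eq_Rintegral => x _; rewrite !partsE; ring.
rewrite [RHS](_ : _ = (Re (u' 0) * Im (v 0) - Re (u 0) * Im (v' 0)) +
   (Im (u' 0) * Re (v 0) - Im (u 0) * Re (v' 0))); last ring.
rewrite -(real_lagrange ur ur' vi vi')// -(real_lagrange ui ui' vr vr')//.
rewrite -RintegralD//; try exact: I.
by apply: eq_Rintegral => x _; rewrite !partsE; ring.
Qed.

Lemma innerDl f g h : L2 f -> L2 g -> L2 h ->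
  inner (fun x => f x + g x) h = inner f h + inner g h.
Proof.
move=> Lf Lg /L2J Lh.
rewrite /inner -cintegralD//; try exact: L2M_integrable.
by apply: eq_cintegral => x _; rewrite mulrDl.
Qed.

Lemma innerZl f h k : L2 f -> L2 h -> inner (fun x => k * f x) h = k * inner f h.
Proof.
move=> Lf /L2J Lh.
rewrite /inner -cintegralZ//; try exact: L2M_integrable.
by apply: eq_cintegral => x _; rewrite mulrA.
Qed.

Lemma innerC f h : L2 f -> L2 h -> inner h f = conjc (inner f h).
Proof.
move=> Lf Lh; rewrite /inner -cintegralJ//.
  by apply: eq_cintegral => x _; rewrite rmorphM /= conjcK mulrC.
by apply: L2M_integrable => //; exact: L2J.
Qed.

Lemma innerDr f g h : L2 f -> L2 g -> L2 h ->
  inner h (fun x => f x + g x) = inner h f + inner h g.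
Proof.
move=> Lf Lg Lh; rewrite innerC ?innerDl//; last exact: L2D.
by rewrite (innerC Lf Lh) (innerC Lg Lh) rmorphD.
Qed.

Lemma innerZr f h k : L2 f -> L2 h ->
  inner h (fun x => k * f x) = conjc k * inner h f.
Proof.
move=> Lf Lh; rewrite innerC ?innerZl//; last exact: L2Z.
by rewrite (innerC Lf Lh) rmorphM.
Qed.

Lemma inner_self f : L2 f ->
  inner f f = (Rintegral leb Rplus (fun x => cabs (f x) ^+ 2))%:C.
Proof.
move=> Lf; apply: complex_ext => /=.
  by apply: eq_Rintegral => x _; rewrite mulcJ.
transitivity (Rintegral leb Rplus (cst 0)).
  by apply: eq_Rintegral => x _; rewrite mulcJ.
by rewrite Rintegral_cst ?mul0r//; exact: measurable_Rplus.
Qed.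

Lemma inner_ae f g h : cmeasurable Rplus f -> cmeasurable Rplus g -> L2 h ->
  ae_equal f g -> inner h f = inner h g.
Proof.
have M (a b : R -> C) : cmeasurable Rplus a -> cmeasurable Rplus b ->
    cmeasurable Rplus (fun x => a x * conjc (b x)).
  move=> [ar ai] [br bi]; split.
    have -> : (fun x => Re (a x * conjc (b x))) =
      (fun x => Re (a x) * Re (b x) + Im (a x) * Im (b x)).
      by apply/funext => x; rewrite !partsE; ring.
    by apply: measurable_funD; exact: measurable_funM.
  have -> : (fun x => Im (a x * conjc (b x))) =
    (fun x => Im (a x) * Re (b x) - Re (a x) * Im (b x)).
    by apply/funext => x; rewrite !partsE; ring.
  by apply: measurable_funB; exact: measurable_funM.
move=> mf mg [mh _] fg; apply: (cintegral_ae measurable_Rplus); try exact: M.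
by apply: filterS fg => x E Dx; rewrite E.
Qed.

End complex_L2.

(** * The first-order system *)

Section systems.
Context {R : realType}.
Local Notation C := (R[i]).
Local Notation leb := (@lebesgue_measure R).

Lemma cmeasurable_cst (D : set R) (k : C) : cmeasurable D (fun=> k).
Proof. by split. Qed.

Lemma cmeasurableM (D : set R) (a b : R -> C) :
  cmeasurable D a -> cmeasurable D b -> cmeasurable D (fun x => a x * b x).
Proof.
move=> [ar ai] [br bi]; split; under eq_fun do rewrite partsE.
  by apply: measurable_funB; exact: measurable_funM.
by apply: measurable_funD; exact: measurable_funM.
Qed.

Lemma cmeasurableB (D : set R) (a b : R -> C) :
  cmeasurable D a -> cmeasurable D b -> cmeasurable D (fun x => a x - b x).
Proof.
move=> [ar ai] [br bi]; split; under eq_fun do rewrite !partsE.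
  exact: measurable_funB.
exact: measurable_funB.
Qed.

Lemma cmeasurableJ (D : set R) (a : R -> C) :
  cmeasurable D a -> cmeasurable D (fun x => conjc (a x)).
Proof.
move=> [ar ai]; split; under eq_fun do rewrite !partsE; first exact: ar.
exact: measurable_funN.
Qed.

Lemma ccvg_bounded (u : nat -> C) z : ccvg u z -> exists M, forall n, norm1 (u n) <= M.
Proof.
have H (v : nat -> R) (l : R) : v n @[n --> \oo] --> l -> exists M, forall n, `|v n| <= M.
  move=> vl; have /cvg_seq_bounded [M [_ HM]] : cvgn v by apply/cvg_ex; exists l.
  by exists (M + 1) => n; apply: HM => //; rewrite ltrDl.
move=> [/H[M1 H1] /H[M2 H2]]; exists (M1 + M2) => n; exact: lerD.
Qed.

Lemma norm1_cvg0 (u : nat -> C) z : ccvg u z -> norm1 (u n - z) @[n --> \oo] --> (0 : R).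
Proof.
move=> [a b]; have -> : (0 : R) = `|Re z - Re z| + `|Im z - Im z|.
  by rewrite !subrr normr0 addr0.
rewrite /norm1; under eq_fun do rewrite !partsE.
by apply: cvgD; apply: cvg_norm; apply: cvgB => //; exact: cvg_cst.
Qed.

Lemma cauchy_cvg_bound (u t : nat -> R) (K : R) : t n @[n --> \oo] --> (0 : R) ->
  (forall n m, `|u n - u m| <= K * (t n + t m)) -> cvgn u.
Proof.
move=> t0 H; apply/cauchy_cvgP/cauchy_exP => e e0.
pose K' := `|K| + 1.
have K'0 : 0 < K' by rewrite ltr_wpDl.
have /cvgrPdist_lt/(_ (e / (2 * K'))) := t0.
have e'0 : 0 < e / (2 * K') by rewrite divr_gt0// mulr_gt0.
move=> /(_ e'0)[N _ HN].
exists (u N); exists N => // n /= Nn.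
rewrite /ball /=; apply: le_lt_trans (H N n) _.
have h1 := HN N (leqnn N); have h2 := HN n Nn.
rewrite /= !sub0r !normrN in h1 h2.
have : e = K' * (e / (2 * K') + e / (2 * K')).
  by field; rewrite gt_eqF.
have : `|t N + t n| < e / (2 * K') + e / (2 * K').
  exact: le_lt_trans (ler_normD _ _) (ltrD h1 h2).
set d := e / (2 * K') => h3 ->.
apply: le_lt_trans (ler_norm _) _; rewrite normrM.
apply: (@le_lt_trans _ _ (K' * `|t N + t n|)).
  by apply: ler_wpM2r => //; rewrite lerDl.
by rewrite ltr_pM2l.
Qed.

Definition climit (u : nat -> C) : C := limn (fun n => Re (u n)) +i* limn (fun n => Im (u n)).

Lemma ccvg_cauchy (u : nat -> C) (t : nat -> R) (K : R) :
  t n @[n --> \oo] --> (0 : R) ->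
  (forall n m, norm1 (u n - u m) <= K * (t n + t m)) -> ccvg u (climit u).
Proof.
move=> t0 H; split => /=.
  apply: (cauchy_cvg_bound (K := K) t0) => n m.
  by apply: le_trans (H n m); apply: le_trans (Re_le_norm1 _); rewrite !partsE.
apply: (cauchy_cvg_bound (K := K) t0) => n m.
by apply: le_trans (H n m); apply: le_trans (Im_le_norm1 _); rewrite !partsE.
Qed.

Lemma primitive_lim (f_ g_ : nat -> R -> C) (f g : R -> C) (B : R -> R) :
  (forall n, primitive (f_ n) (g_ n)) ->
  (forall x, 0 <= x -> ccvg (fun n => f_ n x) (f x)) ->
  (forall x, 0 <= x -> ccvg (fun n => g_ n x) (g x)) ->
  (forall b n x, 0 <= x -> x <= b -> norm1 (g_ n x) <= B b) ->
  primitive f g.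
Proof.
move=> fg cf cg gB; apply/primitiveP; split.
  apply: (@real_primitive_lim R (fun n x => Re (f_ n x)) (fun n x => Re (g_ n x)) _ _ B).
  - by move=> n; have /primitiveP[] := fg n.
  - by move=> x /cf[].
  - by move=> x /cg[].
  - by move=> b n x x0 xb; apply: le_trans (Re_le_norm1 _) (gB _ _ _ x0 xb).
apply: (@real_primitive_lim R (fun n x => Im (f_ n x)) (fun n x => Im (g_ n x)) _ _ B).
- by move=> n; have /primitiveP[] := fg n.
- by move=> x /cf[].
- by move=> x /cg[].
- by move=> b n x x0 xb; apply: le_trans (Im_le_norm1 _) (gB _ _ _ x0 xb).
Qed.

Lemma primitive_norm1 (f g : R -> C) x : primitive f g -> 0 <= x ->
  norm1 (f x) <= norm1 (f 0) + \int[leb]_(t in `[0, x]) norm1 (g t).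
Proof.
move=> /primitiveP[a b] x0.
have [Ia Ea] := a x x0; have [Ib Eb] := b x x0.
rewrite /norm1 RintegralD//; try exact: integrable_norm.
rewrite Ea Eb.
have := ler_normD (Re (f 0)) (\int[leb]_(t in `[0, x]) Re (g t)).
have := ler_normD (Im (f 0)) (\int[leb]_(t in `[0, x]) Im (g t)).
have mI : measurable (`[0, x]%classic : set (measurableTypeR R)) by exact: measurable_itv.
have /= := le_normr_Rintegral mI Ia; have /= := le_normr_Rintegral mI Ib.
lra.
Qed.

Lemma loc_integrable_norm1 (f g : R -> C) : primitive f g ->
  loc_integrable (fun x => norm1 (g x)).
Proof.
move=> /primitiveP[a b]; apply: loc_integrableD; apply: loc_integrable_norm.
  exact: real_primitive_loc a.
exact: real_primitive_loc b.
Qed.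

Lemma loc_integrable_norm1_primitive (f g : R -> C) : primitive f g ->
  loc_integrable (fun x => norm1 (f x)).
Proof.
move=> /primitiveP[a b]; apply: loc_integrableD; apply: loc_integrable_norm.
  exact: loc_integrable_primitive a.
exact: loc_integrable_primitive b.
Qed.

(** Gronwall for the sum [N] of all four norms: the p's are the derivatives of the y's, which adds 1
    to the rate [K]. The constant [c] makes room for a forcing term, which appears when solutions at
    two spectral parameters are compared. *)
Lemma second_order_bound (y1 y2 p1 p2 g1 g2 : R -> C) (K c b : R) :
  primitive y1 p1 -> primitive y2 p2 -> primitive p1 g1 -> primitive p2 g2 ->
  0 <= K -> 0 <= c -> 0 <= b ->
  (forall x, 0 <= x -> x <= b ->
    norm1 (g1 x) + norm1 (g2 x) <= K * (norm1 (y1 x) + norm1 (y2 x)) + c) ->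
  norm1 (y1 b) + norm1 (y2 b) + norm1 (p1 b) + norm1 (p2 b) <=
  (norm1 (y1 0) + norm1 (y2 0) + norm1 (p1 0) + norm1 (p2 0) + c * b) *
    expR ((K + 1) * b).
Proof.
move=> P1 P2 Q1 Q2 K0 c0 b0 H.
pose N x := norm1 (y1 x) + norm1 (y2 x) + norm1 (p1 x) + norm1 (p2 x).
rewrite -/(N b) -/(N 0).
have l1 := loc_integrable_norm1_primitive P1.
have l2 := loc_integrable_norm1_primitive P2.
have l3 := loc_integrable_norm1_primitive Q1.
have l4 := loc_integrable_norm1_primitive Q2.
have l5 := loc_integrable_norm1 Q1; have l6 := loc_integrable_norm1 Q2.
have lN : loc_integrable N.
  exact: loc_integrableD (loc_integrableD (loc_integrableD l1 l2) l3) l4.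
have K10 : 0 <= K + 1 by rewrite addr_ge0.
apply: (gronwall lN K10 b0).
move=> x x0 xb.
have h1 := primitive_norm1 P1 x0; have h2 := primitive_norm1 P2 x0.
have h3 := primitive_norm1 Q1 x0; have h4 := primitive_norm1 Q2 x0.
have I3 := l3 x x0; have I4 := l4 x x0; have I5 := l5 x x0; have I6 := l6 x x0.
have l34 := loc_integrableD l3 l4; have l56 := loc_integrableD l5 l6.
have l36 := loc_integrableD l34 l56.
have E : \int[leb]_(t in `[0, x]) norm1 (p1 t) + \int[leb]_(t in `[0, x]) norm1 (p2 t) +
    (\int[leb]_(t in `[0, x]) norm1 (g1 t) + \int[leb]_(t in `[0, x]) norm1 (g2 t)) =
    \int[leb]_(t in `[0, x]) (norm1 (p1 t) + norm1 (p2 t) + (norm1 (g1 t) + norm1 (g2 t))).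
  rewrite -RintegralD// -RintegralD// -RintegralD//; [exact: l34|exact: l56].
have lK := loc_integrableZ (K + 1) lN.
have lc := loc_integrable_cst c.
have lKc := loc_integrableD lK lc.
have L : \int[leb]_(t in `[0, x]) (norm1 (p1 t) + norm1 (p2 t) + (norm1 (g1 t) + norm1 (g2 t)))
    <= \int[leb]_(t in `[0, x]) ((K + 1) * N t + c).
  apply: le_Rintegral => //; [exact: l36|exact: lKc|].
  move=> t /=; rewrite in_itv/= => /andP[t0 tx].
  have := H t t0 (le_trans tx xb).
  have := norm1_ge0 (p1 t); have := norm1_ge0 (p2 t).
  have := norm1_ge0 (y1 t); have := norm1_ge0 (y2 t).
  have := mulr_ge0 K0 (addr_ge0 (norm1_ge0 (p1 t)) (norm1_ge0 (p2 t))).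
  rewrite /N; clear.
  move: (norm1 (p1 t)) (norm1 (p2 t)) (norm1 (y1 t)) (norm1 (y2 t)) => a1 a2 a3 a4.
  by move: (norm1 (g1 t)) (norm1 (g2 t)) => a5 a6; lra.
have E2 : \int[leb]_(t in `[0, x]) ((K + 1) * N t + c) =
    (K + 1) * \int[leb]_(t in `[0, x]) N t + c * x.
  rewrite RintegralD//; [|exact: lK|exact: lc].
  rewrite RintegralZl//; last exact: lN.
  congr (_ + _); rewrite Rintegral_cst//= lebesgue_measure_itv/= lte_fin.
  have [->|xn0] := eqVneq x 0; first by rewrite ltxx/= !mulr0.
  by rewrite lt_neqAle eq_sym xn0 x0/= oppr0 addr0.
have cxb : c * x <= c * b by exact: ler_wpM2l.
rewrite E2 -E in L; rewrite [N x]/N [N 0]/N.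
set J := \int[leb]_(t in `[0, x]) N t; rewrite -/J in L.
move: h1 h2 h3 h4 L cxb.
set a1 := norm1 (y1 x); set a2 := norm1 (y2 x).
set a3 := norm1 (p1 x); set a4 := norm1 (p2 x).
move: (Rintegral _ _ _) (Rintegral _ _ _) (Rintegral _ _ _) (Rintegral _ _ _) => i1 i2 i3 i4.
move: (norm1 (y1 0)) (norm1 (y2 0)) (norm1 (p1 0)) (norm1 (p2 0)) ((K + 1) * J).
move: (c * x) (c * b) a1 a2 a3 a4; clear => cx cb a1 a2 a3 a4 n1 n2 n3 n4 KJ; lra.
Qed.

(** One column (y1, y2), with derivative (p1, p2), of -eps F'' + Q F = z F. Multiplication by eps
    interchanges the rows, hence the second derivative of y1 contains z y2 and vice versa. *)
Definition sys_solution (q : R -> C) (z : C) (y1 y2 p1 p2 : R -> C) :=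
  [/\ primitive y1 p1, primitive y2 p2,
      primitive p1 (fun x => conjc (q x) * y1 x - z * y2 x) &
      primitive p2 (fun x => q x * y2 x - z * y1 x)].

Lemma sys_solutionD q z y1 y2 p1 p2 u1 u2 r1 r2 :
  sys_solution q z y1 y2 p1 p2 -> sys_solution q z u1 u2 r1 r2 ->
  sys_solution q z (fun x => y1 x + u1 x) (fun x => y2 x + u2 x)
    (fun x => p1 x + r1 x) (fun x => p2 x + r2 x).
Proof.
move=> [a b c d] [e f g h]; split; try exact: primitiveD.
  by have := primitiveD c g; congr primitive; apply/funext => x; ring.
by have := primitiveD d h; congr primitive; apply/funext => x; ring.
Qed.

Lemma sys_solutionZ q z y1 y2 p1 p2 k :
  sys_solution q z y1 y2 p1 p2 ->
  sys_solution q z (fun x => k * y1 x) (fun x => k * y2 x)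
    (fun x => k * p1 x) (fun x => k * p2 x).
Proof.
move=> [a b c d]; split; try exact: primitiveZ.
  by have := primitiveZ k c; congr primitive; apply/funext => x; ring.
by have := primitiveZ k d; congr primitive; apply/funext => x; ring.
Qed.

Lemma norm1_sum4 (a b c d : C) (N := norm1 a + norm1 b + norm1 c + norm1 d) :
  [/\ norm1 a + norm1 b <= N, norm1 a <= N, norm1 b <= N, norm1 c <= N & norm1 d <= N].
Proof.
have := norm1_ge0 a; have := norm1_ge0 b; have := norm1_ge0 c; have := norm1_ge0 d.
by rewrite /N => *; split; lra.
Qed.

(** * Systems with bounded potential: uniqueness, limits of solutions and Lagrange's identity *)

Section bounded_potential.
Variables (q : R -> C) (K : R).
Hypothesis mq : cmeasurable (@Rplus R) q.
Hypothesis qK : forall x, norm1 (q x) <= K.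

Let K0 : 0 <= K. Proof. exact: le_trans (norm1_ge0 _) (qK 0). Qed.

Lemma sys_rhs_bound (z y1 y2 : C) (Z x : R) : norm1 z <= Z ->
  norm1 (conjc (q x) * y1 - z * y2) + norm1 (q x * y2 - z * y1) <=
  (K + Z) * (norm1 y1 + norm1 y2).
Proof.
move=> zZ.
have H (w a b : C) : norm1 w <= K -> norm1 (w * a - z * b) <= K * norm1 a + Z * norm1 b.
  move=> wK; apply: le_trans (norm1D _ _) _; rewrite norm1N; apply: lerD.
    by apply: le_trans (norm1M _ _) _; apply: ler_wpM2r => //; exact: norm1_ge0.
  by apply: le_trans (norm1M _ _) _; apply: ler_wpM2r => //; exact: norm1_ge0.
have h1 := H (conjc (q x)) y1 y2; rewrite norm1J in h1.
have := h1 (qK x); have := H (q x) y2 y1 (qK x); lra.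
Qed.

Lemma sys_solution_unique0 (z : C) y1 y2 p1 p2 : sys_solution q z y1 y2 p1 p2 ->
  y1 0 = 0 -> y2 0 = 0 -> p1 0 = 0 -> p2 0 = 0 ->
  forall x, 0 <= x -> y1 x = 0 /\ y2 x = 0.
Proof.
move=> [s1 s2 s3 s4] i1 i2 i3 i4 x x0.
have KZ0 : 0 <= K + norm1 z by rewrite addr_ge0 ?norm1_ge0.
have n0 : norm1 (0 : C) = 0 by rewrite /norm1 /= normr0 addr0.
have := second_order_bound s1 s2 s3 s4 KZ0 (lexx 0) x0.
rewrite i1 i2 i3 i4 n0 mul0r !addr0 mul0r => H.
have {}H : norm1 (y1 x) + norm1 (y2 x) + norm1 (p1 x) + norm1 (p2 x) <= 0.
  by apply: H => t _ _; rewrite addr0; exact: sys_rhs_bound.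
have [_ h1 h2 _ _] := norm1_sum4 (y1 x) (y2 x) (p1 x) (p2 x).
have Z (w : C) : norm1 w <= 0 -> w = 0.
  move=> h; apply: complex_ext; apply/eqP; rewrite -normr_le0.
    exact: le_trans (Re_le_norm1 w) h.
  exact: le_trans (Im_le_norm1 w) h.
by split; apply: Z; [exact: le_trans h1 H|exact: le_trans h2 H].
Qed.

(** Gronwall applied to the difference of two members of the sequence makes it pointwise Cauchy; the
    limit solves the system by dominated convergence. The solution at [zl] is thereby constructed
    and not taken from an existence theorem. *)
Lemma sys_solution_lim (z : nat -> C) (zl : C) (y1 y2 p1 p2 : nat -> R -> C)
    (a1 a2 b1 b2 : C) :
  (forall n, sys_solution q (z n) (y1 n) (y2 n) (p1 n) (p2 n)) ->
  ccvg z zl -> ccvg (fun n => y1 n 0) a1 -> ccvg (fun n => y2 n 0) a2 ->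
  ccvg (fun n => p1 n 0) b1 -> ccvg (fun n => p2 n 0) b2 ->
  exists Y1 Y2 P1 P2, [/\ sys_solution q zl Y1 Y2 P1 P2,
    forall x, 0 <= x -> ccvg (fun n => y1 n x) (Y1 x),
    forall x, 0 <= x -> ccvg (fun n => y2 n x) (Y2 x) &
    [/\ Y1 0 = a1, Y2 0 = a2, P1 0 = b1 & P2 0 = b2]].
Proof.
move=> sol cz ca1 ca2 cb1 cb2.
have [Z HZ] := ccvg_bounded cz.
have Z0 : 0 <= Z := le_trans (norm1_ge0 _) (HZ 0%N).
have KZ0 : 0 <= K + Z by exact: addr_ge0.
have [A1 HA1] := ccvg_bounded ca1; have [A2 HA2] := ccvg_bounded ca2.
have [B1 HB1] := ccvg_bounded cb1; have [B2 HB2] := ccvg_bounded cb2.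
pose E x := expR ((K + Z + 1) * x).
have E0 x : 0 <= E x by exact: expR_ge0.
have EM x b : x <= b -> E x <= E b.
  by move=> xb; rewrite ler_expR; apply: ler_wpM2l => //; rewrite addr_ge0.
pose A := A1 + A2 + B1 + B2.
pose N n x := norm1 (y1 n x) + norm1 (y2 n x) + norm1 (p1 n x) + norm1 (p2 n x).
have NA n : N n 0 <= A.
  by rewrite /N /A; have := HA1 n; have := HA2 n; have := HB1 n; have := HB2 n; lra.
have N0 n x : 0 <= N n x by rewrite /N !addr_ge0 ?norm1_ge0.
have A0 : 0 <= A by exact: le_trans (N0 0%N 0) (NA 0%N).
have bound n x b : 0 <= x -> x <= b -> N n x <= A * E b.
  move=> x0 xb; have [s1 s2 s3 s4] := sol n.
  have := @second_order_bound (y1 n) (y2 n) (p1 n) (p2 n) _ _ (K + Z) 0 x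
    s1 s2 s3 s4 KZ0 (lexx 0) x0.
  rewrite /= mul0r !addr0 => h; apply: le_trans (h _) _.
    by move=> t _ _; rewrite addr0; apply: sys_rhs_bound.
  rewrite -/(N n 0) -/(E x).
  apply: (@le_trans _ _ (A * E x)); first exact: ler_wpM2r.
  by apply: ler_wpM2l => //; exact: EM.
(* The distance of all data, spectral parameter included, from their limits; it tends to zero and
   measures the Cauchy gap. *)
pose t n := norm1 (z n - zl) + (norm1 (y1 n 0 - a1) + norm1 (y2 n 0 - a2) +
   norm1 (p1 n 0 - b1) + norm1 (p2 n 0 - b2)).
have t0 : t n @[n --> \oo] --> (0 : R).
  have -> : (0 : R) = 0 + (0 + 0 + 0 + 0) by rewrite !addr0.
  by do !apply: cvgD; exact: norm1_cvg0.
have tri (u : nat -> C) l n m : norm1 (u n - u m) <= norm1 (u n - l) + norm1 (u m - l).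
  have -> : u n - u m = (u n - l) + - (u m - l) by ring.
  by apply: le_trans (norm1D _ _) _; rewrite norm1N.
have diff n m x : 0 <= x ->
    norm1 (y1 n x - y1 m x) + norm1 (y2 n x - y2 m x) +
    norm1 (p1 n x - p1 m x) + norm1 (p2 n x - p2 m x) <=
    ((1 + A * E x * x) * E x) * (t n + t m).
  move=> x0; have [s1 s2 s3 s4] := sol n; have [r1 r2 r3 r4] := sol m.
  have AE0 : 0 <= A * E x by exact: mulr_ge0.
  have zz := norm1_ge0 (z n - z m).
  (* The difference solves the system at [z n] with forcing (z n - z m) times the [m]-th solution,
     which the bound [A * E x] controls on [0, x]. *)
  have := second_order_bound (c := norm1 (z n - z m) * (A * E x)) (b := x)
    (primitiveB s1 r1) (primitiveB s2 r2) (primitiveB s3 r3) (primitiveB s4 r4)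
    KZ0 (mulr_ge0 zz AE0) x0.
  move=> /= h; apply: le_trans (h _) _ => {h}.
    move=> s s0 sx.
    have -> : conjc (q s) * y1 n s - z n * y2 n s - (conjc (q s) * y1 m s - z m * y2 m s)
      = (conjc (q s) * (y1 n s - y1 m s) - z n * (y2 n s - y2 m s)) +
        - ((z n - z m) * y2 m s) by ring.
    have -> : q s * y2 n s - z n * y1 n s - (q s * y2 m s - z m * y1 m s)
      = (q s * (y2 n s - y2 m s) - z n * (y1 n s - y1 m s)) +
        - ((z n - z m) * y1 m s) by ring.
    have h1 := sys_rhs_bound (y1 n s - y1 m s) (y2 n s - y2 m s) s (HZ n).
    have h2 := norm1M (z n - z m) (y1 m s).
    have h3 := norm1M (z n - z m) (y2 m s).
    have h4 : norm1 (z n - z m) * (norm1 (y1 m s) + norm1 (y2 m s)) <=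
        norm1 (z n - z m) * (A * E x).
      apply: ler_wpM2l => //; apply: le_trans (bound m s x s0 sx).
      by have [] := norm1_sum4 (y1 m s) (y2 m s) (p1 m s) (p2 m s).
    have := norm1D (conjc (q s) * (y1 n s - y1 m s) - z n * (y2 n s - y2 m s))
      (- ((z n - z m) * y2 m s)).
    have := norm1D (q s * (y2 n s - y2 m s) - z n * (y1 n s - y1 m s))
      (- ((z n - z m) * y1 m s)).
    rewrite !norm1N; lra.
  rewrite -/(E x) [leRHS]mulrAC; apply: ler_wpM2r => //.
  have tz := tri z zl n m.
  have u1 := tri (fun n => y1 n 0) a1 n m; have u2 := tri (fun n => y2 n 0) a2 n m.
  have u3 := tri (fun n => p1 n 0) b1 n m; have u4 := tri (fun n => p2 n 0) b2 n m.
  have tt : norm1 (z n - z m) <= t n + t m.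
    apply: le_trans tz _; rewrite /t.
    have := norm1_ge0 (y1 n 0 - a1); have := norm1_ge0 (y2 n 0 - a2).
    have := norm1_ge0 (p1 n 0 - b1); have := norm1_ge0 (p2 n 0 - b2).
    have := norm1_ge0 (y1 m 0 - a1); have := norm1_ge0 (y2 m 0 - a2).
    have := norm1_ge0 (p1 m 0 - b1); have := norm1_ge0 (p2 m 0 - b2); lra.
  have h5 : norm1 (z n - z m) * (A * E x) * x <= (t n + t m) * (A * E x * x).
    by rewrite -[leLHS]mulrA; apply: ler_wpM2r => //; exact: mulr_ge0.
  rewrite [leRHS](_ : _ = (t n + t m) + (t n + t m) * (A * E x * x)); last ring.
  apply: lerD h5.
  rewrite /t; have := norm1_ge0 (z n - zl); have := norm1_ge0 (z m - zl).
  move: u1 u2 u3 u4 => /=; lra.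
have cau (u : nat -> R -> C) : (forall n m x, 0 <= x -> norm1 (u n x - u m x) <=
    norm1 (y1 n x - y1 m x) + norm1 (y2 n x - y2 m x) +
    norm1 (p1 n x - p1 m x) + norm1 (p2 n x - p2 m x)) ->
    forall x, 0 <= x -> ccvg (fun n => u n x) (climit (fun n => u n x)).
  move=> Hu x x0; apply: (ccvg_cauchy (K := (1 + A * E x * x) * E x) t0) => n m.
  exact: le_trans (Hu n m x x0) (diff n m x x0).
pose lim (u : nat -> R -> C) x := climit (fun n => u n x).
have c1 x : 0 <= x -> ccvg (fun n => y1 n x) (lim y1 x).
  by apply: cau => n m s _; case: (norm1_sum4 (y1 n s - y1 m s) (y2 n s - y2 m s)
    (p1 n s - p1 m s) (p2 n s - p2 m s)).
have c2 x : 0 <= x -> ccvg (fun n => y2 n x) (lim y2 x).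
  by apply: cau => n m s _; case: (norm1_sum4 (y1 n s - y1 m s) (y2 n s - y2 m s)
    (p1 n s - p1 m s) (p2 n s - p2 m s)).
have c3 x : 0 <= x -> ccvg (fun n => p1 n x) (lim p1 x).
  by apply: cau => n m s _; case: (norm1_sum4 (y1 n s - y1 m s) (y2 n s - y2 m s)
    (p1 n s - p1 m s) (p2 n s - p2 m s)).
have c4 x : 0 <= x -> ccvg (fun n => p2 n x) (lim p2 x).
  by apply: cau => n m s _; case: (norm1_sum4 (y1 n s - y1 m s) (y2 n s - y2 m s)
    (p1 n s - p1 m s) (p2 n s - p2 m s)).
have bg n x b : 0 <= x -> x <= b ->
    norm1 (conjc (q x) * y1 n x - z n * y2 n x) + norm1 (q x * y2 n x - z n * y1 n x)
    <= (K + Z) * (A * E b).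
  move=> x0 xb; apply: le_trans (sys_rhs_bound _ _ _ (HZ n)) _.
  apply: ler_wpM2l => //; apply: le_trans (bound n x b x0 xb).
  by case: (norm1_sum4 (y1 n x) (y2 n x) (p1 n x) (p2 n x)).
exists (lim y1), (lim y2), (lim p1), (lim p2); split => //.
  split.
  - apply: (primitive_lim (f_ := y1) (g_ := p1) (B := fun b => A * E b)) => //.
      by move=> n; have [] := sol n.
    move=> b n x x0 xb; apply: le_trans (bound n x b x0 xb).
    by case: (norm1_sum4 (y1 n x) (y2 n x) (p1 n x) (p2 n x)).
  - apply: (primitive_lim (f_ := y2) (g_ := p2) (B := fun b => A * E b)) => //.
      by move=> n; have [] := sol n.
    move=> b n x x0 xb; apply: le_trans (bound n x b x0 xb).
    by case: (norm1_sum4 (y1 n x) (y2 n x) (p1 n x) (p2 n x)).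
  - apply: (primitive_lim (f_ := p1) (g_ := fun n x => conjc (q x) * y1 n x - z n * y2 n x)
      (B := fun b => (K + Z) * (A * E b))) => //.
    + by move=> n; have [] := sol n.
    + move=> x x0; apply: ccvgB; apply: ccvgM => //; try exact: ccvg_cst.
      * exact: c1.
      * exact: c2.
    + move=> b n x x0 xb; apply: le_trans (bg n x b x0 xb).
      by rewrite lerDl norm1_ge0.
  - apply: (primitive_lim (f_ := p2) (g_ := fun n x => q x * y2 n x - z n * y1 n x)
      (B := fun b => (K + Z) * (A * E b))) => //.
    + by move=> n; have [] := sol n.
    + move=> x x0; apply: ccvgB; apply: ccvgM => //; try exact: ccvg_cst.
      * exact: c2.
      * exact: c1.
    + move=> b n x x0 xb; apply: le_trans (bg n x b x0 xb).
      by rewrite lerDr norm1_ge0.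
split.
- exact: ccvg_unique (c1 0 (lexx 0)) ca1.
- exact: ccvg_unique (c2 0 (lexx 0)) ca2.
- exact: ccvg_unique (c3 0 (lexx 0)) cb1.
- exact: ccvg_unique (c4 0 (lexx 0)) cb2.
Qed.

Lemma L2_potential (f : R -> C) : L2 f -> L2 (fun x => q x * f x).
Proof. by move=> Lf; exact: L2_bounded Lf mq qK. Qed.

Lemma L2_potentialJ (f : R -> C) : L2 f -> L2 (fun x => conjc (q x) * f x).
Proof.
move=> Lf; apply: (L2_bounded (K := K)) Lf (cmeasurableJ mq) _ => x.
by rewrite norm1J.
Qed.

(** Because eps swaps components, Lagrange's identity is applied crosswise: y2 with conj g1 and y1
    with conj g2. In each pair the terms with [q] cancel, and the spectral terms add up to the
    left-hand side. *)
Lemma sys_lagrange (z zeta : C) y1 y2 p1 p2 g1 g2 r1 r2 :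
  sys_solution q z y1 y2 p1 p2 -> sys_solution q zeta g1 g2 r1 r2 ->
  L2 y1 -> L2 y2 -> L2 g1 -> L2 g2 ->
  (z - conjc zeta) * (inner y1 g1 + inner y2 g2) =
  conjc (g1 0) * p2 0 + conjc (g2 0) * p1 0
    - conjc (r1 0) * y2 0 - conjc (r2 0) * y1 0.
Proof.
move=> [s1 s2 s3 s4] [t1 t2 t3 t4] Ly1 Ly2 Lg1 Lg2.
have Lp1 := L2B (L2_potentialJ Ly1) (L2Z z Ly2).
have Lp2 := L2B (L2_potential Ly2) (L2Z z Ly1).
have Lr1 := L2J (L2B (L2_potentialJ Lg1) (L2Z zeta Lg2)).
have Lr2 := L2J (L2B (L2_potential Lg2) (L2Z zeta Lg1)).
have Jg1 := L2J Lg1; have Jg2 := L2J Lg2.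
have e1 := half_line_lagrange s2 s4 (primitiveJ t1) (primitiveJ t3) Ly2 Lp2 Jg1 Lr1.
have e2 := half_line_lagrange s1 s3 (primitiveJ t2) (primitiveJ t4) Ly1 Lp1 Jg2 Lr2.
have mR := @measurable_Rplus R.
transitivity ((p2 0 * conjc (g1 0) - y2 0 * conjc (r1 0)) +
  (p1 0 * conjc (g2 0) - y1 0 * conjc (r2 0))); last ring.
rewrite -e1 -e2.
have I1 := L2M_integrable Ly1 Jg1; have I2 := L2M_integrable Ly2 Jg2.
have IB (a b c d : R -> C) : L2 a -> L2 b -> L2 c -> L2 d ->
    cintegrable leb (@Rplus R) (fun x => a x * b x - c x * d x).
  move=> La Lb Lc Ld.
  exact: (cintegrableD mR (L2M_integrable La Lb) (cintegrableN mR (L2M_integrable Lc Ld))).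
have B1 := IB _ _ _ _ Ly2 Lr1 Lp2 Jg1; have B2 := IB _ _ _ _ Ly1 Lr2 Lp1 Jg2.
rewrite -(cintegralD mR B1 B2) /inner -(cintegralD mR I1 I2).
rewrite -(cintegralZ mR _ (cintegrableD mR I1 I2)).
apply: eq_cintegral => x _.
rewrite !rmorphB !rmorphM /= !conjcK; ring.
Qed.

End bounded_potential.
End systems.

(** * The operator and its modulus *)

Section potential.
Context {R : realType}.
Local Notation C := (R[i]).
Local Notation leb := (@lebesgue_measure R).

(** A Borel function equal to [q] almost everywhere need not be bounded, so its real and imaginary
    parts are clamped to [-2K, 2K]. The level 2K, from norm1 <= 2 cabs, leaves it unchanged wherever
    it agrees with [q] on the half-line. *)
Lemma bounded_borel_representative (q : R -> C) : lebesgue_measurable q ->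
  (exists K : R, forall x : R, 0 < x -> cabs (q x) <= K) ->
  exists (q1 : R -> C) (K : R), [/\ cmeasurable Rplus q1,
    forall x, norm1 (q1 x) <= K & ae_equal q q1].
Proof.
move=> [g [mr mi] qg] [K HK].
have c0 (w : C) : 0 <= cabs w by case: w => a b; exact: sqrtr_ge0.
have K0 : 0 <= K by exact: le_trans (c0 _) (HK 1 ltr01).
pose k := 2 * K.
have k0 : 0 <= k by rewrite mulr_ge0.
pose clamp (x : R) := Num.max (- k) (Num.min k x).
have clamp_le x : `|clamp x| <= k.
  rewrite /clamp ler_norml le_max lexx/= ge_max ge_min lexx/= andbT.
  by apply: (le_trans _ k0); rewrite oppr_le0.
have clamp_id x : `|x| <= k -> clamp x = x.
  by rewrite ler_norml => /andP[h1 h2]; rewrite /clamp (min_r h2) (max_r h1).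
have mclamp (f : R -> R) : measurable_fun (@Rplus R) f ->
    measurable_fun (@Rplus R) (fun x => clamp (f x)).
  by move=> mf; apply: measurable_maxr => //; apply: measurable_minr.
exists (fun x => clamp (Re (g x)) +i* clamp (Im (g x))), (k + k); split.
- by split; exact: mclamp.
- by move=> x; rewrite /norm1 /= lerD.
- apply: filterS qg => x H Dx; rewrite (H Dx).
  have x0 : 0 < x by move: Dx; rewrite /Rplus /= in_itv/= andbT.
  have h : norm1 (g x) <= k.
    rewrite -(H Dx); apply: le_trans (norm1_le_cabs _) _.
    by rewrite ler_pM2l ?ltr0n// HK.
  by apply: complex_ext; rewrite /= clamp_id//;
    [exact: le_trans (Re_le_norm1 _) h|exact: le_trans (Im_le_norm1 _) h].
Qed.

Lemma sum2 (V : nmodType) (f : 'I_2 -> V) : \sum_k f k = f 0 + f 1.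
Proof.
by rewrite !big_ord_recl big_ord0 addr0; congr (_ + f _); exact: val_inj.
Qed.

Lemma epsmxE (A : 'M[C]_2) j :
  ((epsmx *m A) 0 j = A 1 j) * ((epsmx *m A) 1 j = A 0 j).
Proof.
by split; rewrite !mxE sum2 !mxE /= ?mul0r ?mul1r ?add0r ?addr0.
Qed.

Lemma QmxE (q : R -> C) x (A : 'M[C]_2) j :
  ((Qmx q x *m A) 0 j = q x * A 1 j) * ((Qmx q x *m A) 1 j = conjc (q x) * A 0 j).
Proof.
by split; rewrite !mxE sum2 !mxE /= ?mul0r ?add0r ?addr0.
Qed.

Section with_representative.
Variables (q q1 : R -> C) (K : R).
Hypothesis mq : cmeasurable (@Rplus R) q1.
Hypothesis qK : forall x, norm1 (q1 x) <= K.
Hypothesis qq1 : ae_equal q q1.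

Lemma mx_solution_column (z : C) (F F' : R -> 'M[C]_2) j : mx_solution q z F F' ->
  sys_solution q1 z (fun x => F x 0 j) (fun x => F x 1 j)
    (fun x => F' x 0 j) (fun x => F' x 1 j).
Proof.
move=> [F'' [PF PF' E]].
have m0 := primitive_cmeasurable (PF 0 j); have m1 := primitive_cmeasurable (PF 1 j).
split; [exact: PF|exact: PF| |].
  apply: (primitive_ae (PF' 0 j)).
    apply: cmeasurableB; first by apply: cmeasurableM => //; exact: cmeasurableJ.
    by apply: cmeasurableM => //; exact: cmeasurable_cst.
  apply: filterS2 qq1 E => x h1 h2 Dx; have := h2 Dx => /(congr1 (fun M : 'M[C]_2 => M 1 j)).
  rewrite !mxE; have := epsmxE (F'' x) j; rewrite !mxE => -[_ ->].
  have := QmxE q x (F x) j; rewrite !mxE => -[_ ->]; rewrite (h1 Dx) => <-; ring.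
apply: (primitive_ae (PF' 1 j)).
  apply: cmeasurableB; first by apply: cmeasurableM.
  by apply: cmeasurableM => //; exact: cmeasurable_cst.
apply: filterS2 qq1 E => x h1 h2 Dx; have := h2 Dx => /(congr1 (fun M : 'M[C]_2 => M 0 j)).
rewrite !mxE; have := epsmxE (F'' x) j; rewrite !mxE => -[-> _].
have := QmxE q x (F x) j; rewrite !mxE => -[-> _]; rewrite (h1 Dx) => <-; ring.
Qed.

(** The equation for [e] is the second one of the system with y1 = conj e; the first is its complex
    conjugate, [lam] being real. *)
Lemma distinguished_solution (alpha : option C) (lam : R) e e' :
  is_distinguished q alpha lam e e' ->
  sys_solution q1 lam%:C (fun x => conjc (e x)) e (fun x => conjc (e' x)) e'.
Proof.
move=> [[e'' [P1 P2 E]] _ [me _] _].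
have Q2 : primitive e' (fun x => q1 x * e x - lam%:C * conjc (e x)).
  apply: (primitive_ae P2).
    apply: cmeasurableB; first exact: cmeasurableM.
    by apply: cmeasurableM; [exact: cmeasurable_cst|exact: cmeasurableJ].
  apply: filterS2 qq1 E => x h1 h2 Dx; rewrite -(h2 Dx) (h1 Dx); ring.
split => //; first exact: primitiveJ.
have := primitiveJ Q2; congr primitive; apply/funext => x.
by apply: complex_ext; rewrite !partsE /=; ring.
Qed.

(** The second component determines the first. If the second component of the difference is zero, so
    is its derivative, and the equation for that derivative then reads lam d1 = 0. *)
Lemma sys_proportional (lam : C) y1 y2 p1 p2 g1 g2 r1 r2 (k : C) : lam != 0 ->
  sys_solution q1 lam y1 y2 p1 p2 -> sys_solution q1 lam g1 g2 r1 r2 ->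
  ae_equal y2 (fun x => k * g2 x) -> forall x, 0 <= x ->
  [/\ y1 x = k * g1 x, y2 x = k * g2 x, p1 x = k * r1 x & p2 x = k * r2 x].
Proof.
move=> lam0 sy sg ae.
have := sys_solutionD sy (sys_solutionZ (- k) sg).
set d1 := fun x => y1 x + _; set d2 := fun x => y2 x + _.
set f1 := fun x => p1 x + _; set f2 := fun x => p2 x + _ => -[s1 s2 s3 s4].
have d20 : forall x, 0 <= x -> d2 x = 0.
  apply: (primitive_ae0 s2); apply: filterS ae => x h Dx; rewrite /d2 (h Dx); ring.
have f20 : forall x, 0 <= x -> f2 x = 0 by exact: (primitive_zero s2 s4).
have d10 : forall x, 0 <= x -> d1 x = 0.
  have Pd := primitiveZ (- lam) s1.
  have Pf2 : primitive f2 (fun x => - lam * d1 x).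
    apply: primitive_ae s4 (primitive_cmeasurable Pd) _.
    apply: aeW => x; rewrite /Rplus /= in_itv/= andbT => x0.
    rewrite (d20 x (ltW x0)); ring.
  move=> x x0; have /eqP := primitive_zero Pf2 Pd f20 x0.
  by rewrite mulf_eq0 oppr_eq0 (negbTE lam0)/= => /eqP.
have f10 : forall x, 0 <= x -> f1 x = 0 by exact: (primitive_zero s1 s3).
have H (a b : C) : a + - k * b = 0 -> a = k * b.
  by move/eqP; rewrite mulNr subr_eq0 => /eqP.
by move=> x x0; split; apply: H; [exact: d10|exact: d20|exact: f10|exact: f20].
Qed.

(** Both pairs lie on the same complex line, so their determinant vanishes; this removes the
    boundary term from Lagrange's identity. *)
Lemma bc_wronskian (alpha : option C) a a' b b' : bc alpha a a' -> bc alpha b b' ->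
  a' * b - a * b' = 0.
Proof.
case: alpha => [al|] /=; last by move=> -> ->; rewrite mulr0 mul0r subrr.
move=> /eqP; rewrite addr_eq0 => /eqP -> /eqP; rewrite addr_eq0 => /eqP ->; ring.
Qed.

Lemma schrodinger_system (alpha : option C) (lam : C) y1 y2 p1 p2 :
  sys_solution q1 lam y1 y2 p1 p2 -> L2 y1 -> L2 y2 -> bc alpha (y2 0) (p2 0) ->
  schrodinger q alpha y2 (fun x => lam * y1 x).
Proof.
move=> [s1 s2 s3 s4] L1 L2' B.
have Lp := L2B (L2_potential mq qK L2') (L2Z lam L1).
exists y2, p2, (fun x => q1 x * y2 x - lam * y1 x); split => //.
- by split => //; exact: L2_derivative s2 s4 L2' Lp.
- by split => //; exact: aeW.
- split; first exact: L2Z.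
  apply: filterS qq1 => x h Dx; rewrite (h Dx); ring.
Qed.

(** For w in the domain of H, the pairs of w and of conj y1 at 0 satisfy one boundary condition, so
    Lagrange's identity has no boundary term. With [schrodinger_system] this gives H^* H y2 = lam^2
    y2; the factors [lam] are kept in the form in which the two graphs compose. *)
Lemma adjoint_schrodinger_system (alpha : option C) (lam : R) y1 y2 p1 p2 :
  sys_solution q1 lam%:C y1 y2 p1 p2 -> L2 y1 -> L2 y2 ->
  bc alpha (conjc (y1 0)) (conjc (p1 0)) ->
  op_adjoint (schrodinger q alpha) (fun x => lam%:C * y1 x)
    (fun x => lam%:C * (lam%:C * y2 x)).
Proof.
move=> [s1 s2 s3 s4] L1 L2' B; split; [exact: L2Z|exact: (L2Z _ (L2Z _ L2'))|].
move=> u v [w [w' [w'' [[P1 P2 Lw Lw' Lw''] Bw [Lu uw] [Lv vw]]]]].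
have Lp := L2J (L2B (L2_potentialJ mq qK L1) (L2Z lam%:C L2')).
have W := half_line_lagrange P1 P2 (primitiveJ s1) (primitiveJ s3) Lw Lw'' (L2J L1) Lp.
rewrite (bc_wronskian Bw B) in W.
have LT : L2 (fun x => lam%:C * y2 x) by exact: L2Z.
rewrite (innerZr _ L1 Lv) (innerZr _ LT Lu); congr (_ * _).
(* [v] is determined only up to null sets and through [q]; [v1] is its version with the bounded
   Borel potential. *)
pose v1 x := - w'' x + q1 x * w x.
have Lv1 : L2 v1 by apply: L2D; [exact: L2N|exact: L2_potential].
have vv1 : ae_equal v v1.
  by apply: filterS2 vw qq1 => x h1 h2 Dx; rewrite /v1 (h1 Dx) (h2 Dx).
rewrite (innerC L1 Lv) (inner_ae Lv.1 Lv1.1 L1 vv1) -(innerC L1 Lv1).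
rewrite (innerC LT Lu) (inner_ae Lu.1 Lw.1 LT uw) -(innerC LT Lw).
apply/eqP; rewrite -subr_eq0; apply/eqP; rewrite -W.
have mR := @measurable_Rplus R.
have I1 := L2M_integrable Lv1 (L2J L1).
have I2 := L2M_integrable Lw (L2J LT).
rewrite /inner -[X in _ - X]mul1r -mulNr -(cintegralZ mR _ I2).
rewrite -(cintegralD mR I1 (cintegrableZ mR _ I2)).
apply: eq_cintegral => x _; rewrite /v1; apply: complex_ext; rewrite !partsE /=; ring.
Qed.

End with_representative.
End potential.

(** * From eigenvectors of H^* H to eigenvectors of |H| *)

Section modulus.
Context {R : realType}.
Local Notation C := (R[i]).
Local Notation leb := (@lebesgue_measure R).
Implicit Types (T P : @op R).

Lemma inner_self_eq0 (f : R -> C) : L2 f -> inner f f = 0 -> ae_equal f (fun=> 0).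
Proof.
move=> Lf; rewrite inner_self// => /(congr1 (@complex.Re R)) /= E.
have [mf If] := Lf.
have I0 : (\int[leb]_(x in Rplus) `|(cabs (f x) ^+ 2)%:E|)%E = 0%E.
  under eq_integral do rewrite gee0_abs ?lee_fin ?sqr_ge0//.
  rewrite -[LHS]fineK; first by rewrite -[fine _]/(Rintegral _ _ _) E.
  exact: (integrable_fin_num (@measurable_Rplus R) If).
have := (ae_eq_integral_abs leb (@measurable_Rplus R) (measurable_int _ If)).1 I0.
apply: filterS => x h Dx; have := h Dx => -[] /eqP; rewrite sqrf_eq0 => /eqP.
exact: Normc.eq0_normc.
Qed.

(** A relation of type [op] is not linear by definition, but an adjoint is; a self-adjoint operator
    inherits its linearity from here. *)
Lemma op_adjoint_comb P f g f' g' (a : C) : (forall u v, P u v -> L2 u /\ L2 v) ->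
  op_adjoint P f g -> op_adjoint P f' g' ->
  op_adjoint P (fun x => f x + a * f' x) (fun x => g x + a * g' x).
Proof.
move=> PL [Lf Lg H] [Lf' Lg' H']; split; try by apply: L2D => //; exact: L2Z.
move=> u v Puv; have [Lu Lv] := PL u v Puv.
by rewrite !innerDr ?innerZr ?(H u v Puv) ?(H' u v Puv)//; exact: L2Z.
Qed.

(* If [P^2 f = lam^2 f] and [h = P f], then [k = h - lam f] satisfies
   [P k = - lam k], so [k = 0] by nonnegativity of [P]. *)
Lemma modulus_eigenvector T P (lam : R) f : is_modulus T P -> 0 < lam ->
  op_comp (op_adjoint T) T f (fun x => lam%:C * (lam%:C * f x)) ->
  eigenvector P lam%:C f.
Proof.
move=> [[_ PP] Pge0 PT] lam0 /PT [h [Pfh Phf]].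
have PL u v : P u v -> L2 u /\ L2 v by move=> /PP[].
have [Lf Lh] := PL _ _ Pfh.
pose k x := h x + (- lam%:C) * f x.
have Lk : L2 k by apply: L2D => //; exact: L2Z.
have Pk : P k (fun x => (- lam%:C) * k x).
  apply/PP; have /PP A1 := Phf; have /PP A2 := Pfh.
  have := op_adjoint_comb (- lam%:C) PL A1 A2.
  by congr op_adjoint; apply/funext => x; rewrite /k; ring.
have k0 : inner k k = 0.
  have := Pge0 _ _ Pk; rewrite innerZl// inner_self//.
  set r := Rintegral _ _ _ => r0.
  have rge0 : 0 <= r by apply: Rintegral_ge0 => x _; exact: sqr_ge0.
  have : 0 <= - lam * r.
    by move: r0; rewrite lecE !partsE /= oppr0 !mul0r mulr0 subr0 => /andP[].
  rewrite mulNr oppr_ge0 pmulr_rle0// => rle0.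
  by congr Complex; apply/le_anti; rewrite rle0.
have hf : ae_equal h (fun x => lam%:C * f x).
  apply: filterS (inner_self_eq0 Lk k0) => x H Dx.
  by apply/eqP; rewrite -subr_eq0 -mulNr; apply/eqP; exact: H.
(* [h] equals lam f only almost everywhere, while an eigenvector needs that exact function in the
   graph. The adjoint does not see null sets, so the exchange is made there. *)
apply/PP; have /PP[_ _ A] := Pfh; split=> //; first exact: L2Z.
move=> u v Puv; rewrite (A u v Puv); have [Lu Lv] := PL u v Puv.
by apply: inner_ae => //; [exact: Lh.1|exact: (L2Z _ Lf).1].
Qed.

Lemma simple_eigenvalue_proportional P (lam : C) (e f : R -> C) :
  simple_eigenvalue P lam -> eigenvector P lam e -> eigenvector P lam f ->
  ~ ae_equal e (fun=> 0) -> exists k : C, ae_equal f (fun x => k * e x).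
Proof.
move=> [g [_ _ H]] /H[c Ec] /H[d Ed] e0.
exists (d / c); apply: filterS2 (Ec) (Ed) => x h1 h2 Dx; rewrite (h1 Dx) (h2 Dx).
have [c0|c0] := eqVneq c 0; last by rewrite mulrA divfK.
by exfalso; apply: e0; apply: filterS Ec => y h Dy; rewrite (h Dy) c0 mul0r.
Qed.

End modulus.

(** * Herglotz representation *)

Section quadratic_forms.
Context {R : realType}.
Local Notation C := (R[i]).
Implicit Types (M N : 'M[C]_2) (v : 'cV[C]_2).

Lemma quadformE M v : quadform M v =
  (conjc (v 0 0) * M 0 0 + conjc (v 1 0) * M 1 0) * v 0 0 +
  (conjc (v 0 0) * M 0 1 + conjc (v 1 0) * M 1 1) * v 1 0.
Proof. by rewrite /quadform mxE sum2 !mxE !sum2 !mxE. Qed.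

Lemma quadformB M N v : quadform (M - N) v = quadform M v - quadform N v.
Proof. by rewrite !quadformE !mxE; ring. Qed.

Definition col2 (a b : C) : 'cV[C]_2 := \col_i (if i == 0 then a else b).

Lemma col2E (a b : C) : (col2 a b 0 0 = a) * (col2 a b 1 0 = b).
Proof. by rewrite !mxE. Qed.

Lemma quadform_e0 M : quadform M (col2 1 0) = M 0 0.
Proof. by rewrite quadformE !col2E conjc1 conjc0; ring. Qed.

(** Scalar measures give access to quadratic forms only; this recovers the off-diagonal entry, the
    one that carries conj psi. *)
Lemma quadform_polarization M :
  M 1 0 = 2^-1 * ((quadform M (col2 1 1) - (quadform M (col2 1 0) + quadform M (col2 0 1)))
    + 'i%C * (quadform M (col2 1 'i%C) - (quadform M (col2 1 0) + quadform M (col2 0 1)))).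
Proof.
have i2 : ('i%C : C) * 'i%C = -1 by rewrite -expr2 sqr_i.
have ci : conjc ('i%C : C) = - 'i%C by apply: complex_ext; rewrite !partsE /= ?oppr0.
have two : (2 : C) != 0 by rewrite pnatr_eq0.
apply: (mulfI two); rewrite mulrA divff// mul1r.
rewrite !quadformE !col2E conjc1 conjc0 ci.
set i := 'i%C in i2 *.
transitivity ((1 - i * i) * M 1 0 + (1 + i * i) * M 0 1 - (1 + i * i) * i * M 1 1); last ring.
rewrite i2; ring.
Qed.

End quadratic_forms.

(** * Recovering an atom of the matrix measure from its Herglotz integral *)

Section herglotz.
Context {R : realType}.
Local Notation C := (R[i]).

(** Exhaustion by the intervals [-n, n]. [mx_integral] yields a measure for each integrand, fixed
    only on bounded Borel sets; by this lemma all of them agree. *)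
Lemma eq_measure_bounded (m1 m2 : {measure set (measurableTypeR R) -> \bar R}) :
  (forall B : set R, bounded_borel B -> m1 B = m2 B) ->
  forall A : set (measurableTypeR R), measurable A -> m1 A = m2 A.
Proof.
move=> H A mA.
pose F (n : nat) : set (measurableTypeR R) := A `&` `[- n%:R, n%:R]%classic.
have mI n : measurable (`[- n%:R, n%:R]%classic : set (measurableTypeR R)).
  exact: measurable_itv.
have mF n : measurable (F n) by exact: measurableI.
have UF : \bigcup_n F n = A.
  rewrite -setI_bigcupr; apply/setIidPl => x _.
  exists (Num.truncn `|x|).+1 => //=; rewrite in_itv/= -ler_norml.
  exact/ltW/Num.Theory.truncnS_gt.
have ndF : nondecreasing_seq F.
  apply/nondecreasing_seqP => n; apply/subsetPset => x [Ax] /= h; split => //.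
  move: h; rewrite /= !in_itv/= -!ler_norml => h.
  by apply: le_trans h _; rewrite ler_nat.
have c (m : {measure set (measurableTypeR R) -> \bar R}) : m (F n) @[n --> \oo] --> m A.
  by rewrite -[in X in _ --> X]UF; apply: nondecreasing_cvg_mu => //; rewrite UF.
have E : (fun n => m1 (F n)) = (fun n => m2 (F n)).
  apply/funext => n; apply: H; split; first exact: mF.
  exists n%:R; split; first exact: num_real.
  by move=> y ny x [_] /=; rewrite in_itv/= -ler_norml => h; apply: le_trans h (ltW ny).
have c1 := c m1; rewrite E in c1.
by rewrite -(cvg_lim _ c1)// -(cvg_lim _ (c m2)).
Qed.

Lemma herglotz_kernelE (lam h t : R) :
  (Re (herglotz_kernel (lam +i* h) t) =
     (t - lam) / ((t - lam) ^+ 2 + h ^+ 2) - t / (1 + t ^+ 2)) *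
  (Im (herglotz_kernel (lam +i* h) t) = h / ((t - lam) ^+ 2 + h ^+ 2)).
Proof.
split; rewrite /herglotz_kernel !partsE /= sub0r sqrrN//.
by rewrite mulNr opprK subr0.
Qed.

(** A dominating function independent of [h], integrable because the integral of 1/(1 + t^2) against
    the measure converges. The constant 4 is generous and serves both parts. *)
Lemma herglotz_kernel_bound (lam h t : R) : 0 < h -> h <= 1 ->
  `|h * Re (herglotz_kernel (lam +i* h) t)| <= 4 * (1 + lam ^+ 2) * (1 + t ^+ 2)^-1 /\
  `|h * Im (herglotz_kernel (lam +i* h) t)| <= 4 * (1 + lam ^+ 2) * (1 + t ^+ 2)^-1.
Proof.
move=> h0 h1; rewrite !herglotz_kernelE.
have [s ->] : exists s, t = lam + s by exists (t - lam); ring.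
have -> : lam + s - lam = s by ring.
have t1 : 0 < 1 + (lam + s) ^+ 2 by rewrite ltr_wpDr ?sqr_ge0.
have d0 : 0 < s ^+ 2 + h ^+ 2 by rewrite ltr_wpDl ?sqr_ge0 ?exprn_gt0.
have t1n := lt0r_neq0 t1; have d0n := lt0r_neq0 d0.
have hh : h ^+ 2 <= 1 by rewrite expr_le1// ltW.
have key (a : R) : `|a| <= 4 * (1 + lam ^+ 2) * (s ^+ 2 + h ^+ 2) ->
    `|a / ((s ^+ 2 + h ^+ 2) * (1 + (lam + s) ^+ 2))| <=
    4 * (1 + lam ^+ 2) * (1 + (lam + s) ^+ 2)^-1.
  move=> H; have dt := mulr_gt0 d0 t1.
  rewrite normrM normfV (gtr0_norm dt) ler_pdivrMr//.
  rewrite (_ : 4 * _ / _ * _ = 4 * (1 + lam ^+ 2) * (s ^+ 2 + h ^+ 2))//.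
  by field.
have l2 := sqr_ge0 lam; have s2 := sqr_ge0 s; have hs2 := sqr_ge0 h.
have hle : h ^+ 2 * s ^+ 2 <= s ^+ 2 by rewrite ler_piMl.
have hl : h ^+ 2 * lam ^+ 2 <= lam ^+ 2 by rewrite ler_piMl.
split.
  (* Over the common denominator the quadratic growth in t cancels: with t = lam + s, s (1 + t^2) -
     t (s^2 + h^2) = s (1 + lam t) - t h^2. *)
  rewrite (_ : h * _ = (h * (s * (1 + lam * (lam + s)) - (lam + s) * h ^+ 2)) /
    ((s ^+ 2 + h ^+ 2) * (1 + (lam + s) ^+ 2))); last first.
    by field; rewrite d0n t1n.
  apply: key.
  (* |h s| <= (s^2 + h^2) / 2 and |lam| <= (1 + lam^2) / 2 *)
  have a1 : `|h * s| <= (s ^+ 2 + h ^+ 2) / 2.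
    rewrite ler_norml; apply/andP; split.
      by have := sqr_ge0 (h + s); rewrite sqrrD; lra.
    by have := sqr_ge0 (h - s); rewrite sqrrB; lra.
  have a2 : `|lam| <= (1 + lam ^+ 2) / 2.
    rewrite ler_norml; apply/andP; split.
      by have := sqr_ge0 (1 + lam); rewrite sqrrD expr1n; lra.
    by have := sqr_ge0 (1 - lam); rewrite sqrrB expr1n; lra.
  (* Grouped so that each of the two summands is at most half of (1 + lam^2)(s^2 + h^2). *)
  have e : h * (s * (1 + lam * (lam + s)) - (lam + s) * h ^+ 2) =
    (h * s) * (1 + lam ^+ 2 - h ^+ 2) + lam * (h * (s ^+ 2 - h ^+ 2)) by ring.
  rewrite e; apply: le_trans (ler_normD _ _) _; rewrite !normrM.
  have b1 : `|1 + lam ^+ 2 - h ^+ 2| <= 1 + lam ^+ 2.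
    by rewrite ler_norml; apply/andP; split; lra.
  have b2 : `|h| * `|s ^+ 2 - h ^+ 2| <= s ^+ 2 + h ^+ 2.
    apply: (@le_trans _ _ (1 * (s ^+ 2 + h ^+ 2))); last by rewrite mul1r.
    apply: ler_pM => //; first by rewrite gtr0_norm.
    by rewrite ler_norml; apply/andP; split; lra.
  have p1 : `|h| * `|s| * `|1 + lam ^+ 2 - h ^+ 2| <= (s ^+ 2 + h ^+ 2) / 2 * (1 + lam ^+ 2).
    by apply: ler_pM => //; rewrite ?mulr_ge0 -?normrM.
  have p2 : `|lam| * (`|h| * `|s ^+ 2 - h ^+ 2|) <= (1 + lam ^+ 2) / 2 * (s ^+ 2 + h ^+ 2).
    by apply: ler_pM => //; rewrite mulr_ge0.
  apply: le_trans (lerD p1 p2) _.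
  have : 0 <= (1 + lam ^+ 2) * (s ^+ 2 + h ^+ 2) by rewrite mulr_ge0 ?addr_ge0.
  lra.
rewrite (_ : h * _ = (h ^+ 2 * (1 + (lam + s) ^+ 2)) /
    ((s ^+ 2 + h ^+ 2) * (1 + (lam + s) ^+ 2))); last first.
  by field; rewrite d0n t1n.
apply: key; rewrite ger0_norm; last by rewrite mulr_ge0// ltW.
have ls : (lam + s) ^+ 2 <= 2 * lam ^+ 2 + 2 * s ^+ 2.
  by have := sqr_ge0 (lam - s); rewrite sqrrB sqrrD; lra.
have c1 := ler_wpM2l hs2 ls.
have c2 : 0 <= lam ^+ 2 * s ^+ 2 by rewrite mulr_ge0.
have c3 : 0 <= lam ^+ 2 * h ^+ 2 by rewrite mulr_ge0.
lra.
Qed.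

(** The numbers 1/(n + 1): positive, at most 1 and tending to 0. One sequence suffices, and the
    convergence theorems for integrals are sequential. *)
Local Notation eta := (@harmonic R).

Let eta_gt0 n : 0 < eta n. Proof. exact: harmonic_gt0. Qed.

Let eta_le1 n : eta n <= 1. Proof. by rewrite /harmonic /= invf_le1 ?ltr0n// ler1n. Qed.

Let eta_cvg : eta n @[n --> \oo] --> (0 : R). Proof. exact: cvg_harmonic. Qed.

(** The imaginary part times eta is eta^2 / ((t - lam)^2 + eta^2), which is 1 for every n at t = lam
    and tends to 0 elsewhere; this is what isolates the atom. *)
Lemma herglotz_kernel_cvg (lam t : R) :
  eta n * Re (herglotz_kernel (lam +i* eta n) t) @[n --> \oo] --> (0 : R) /\
  eta n * Im (herglotz_kernel (lam +i* eta n) t) @[n --> \oo] --> (\1_[set lam] t : R).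
Proof.
have e2 : eta n ^+ 2 @[n --> \oo] --> (0 : R).
  by rewrite -(mulr0 0); under eq_fun do rewrite expr2; exact: cvgM.
have [->|tl] := eqVneq t lam.
  split.
    under eq_fun do rewrite herglotz_kernelE subrr mul0r sub0r.
    rewrite -(mul0r (- (lam / (1 + lam ^+ 2)))).
    by apply: cvgM => //; exact: cvg_cst.
  rewrite indicE mem_set//.
  have E n : eta n * Im (herglotz_kernel (lam +i* eta n) lam) = 1.
    rewrite herglotz_kernelE subrr expr0n/= add0r; field.
    exact: lt0r_neq0.
  by under eq_fun do rewrite E; exact: cvg_cst.
have s0 : (t - lam) ^+ 2 != 0 by rewrite expf_eq0/= subr_eq0.
have D : ((t - lam) ^+ 2 + eta n ^+ 2)^-1 @[n --> \oo] --> ((t - lam) ^+ 2)^-1.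
  apply: cvgV => //; rewrite -[X in _ --> X]addr0; apply: cvgD => //; exact: cvg_cst.
split.
  under eq_fun do rewrite herglotz_kernelE.
  rewrite -(mul0r ((t - lam) * ((t - lam) ^+ 2)^-1 - t / (1 + t ^+ 2))).
  apply: cvgM => //; apply: cvgB; last exact: cvg_cst.
  by apply: cvgM => //; exact: cvg_cst.
have c0 : eta n * Im (herglotz_kernel (lam +i* eta n) t) @[n --> \oo] --> (0 : R).
  under eq_fun do rewrite herglotz_kernelE.
  rewrite -(mul0r (0 * ((t - lam) ^+ 2)^-1)).
  by apply: cvgM => //; apply: cvgM.
by rewrite indicE memNset// => /= E; rewrite E eqxx in tl.
Qed.

Section limit.
Variables (Sigma : set R -> 'M[C]_2) (N : 'M[C]_2) (M : C -> 'M[C]_2) (lam : R).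
Hypothesis Spsd : psd_matrix_measure Sigma.
Hypothesis SN : mx_integral Sigma (fun t => ((1 + t ^+ 2)^-1)%:C) N.
Hypothesis SM : forall z : C, Im z != 0 ->
  mx_integral Sigma (herglotz_kernel z) (M z - Remx (M (0 +i* 1))).

Lemma bounded_borel1 : bounded_borel [set lam].
Proof.
split; first exact: measurable_set1.
exists `|lam|; split; first exact: num_real.
by move=> y ly x /= ->; exact: ltW.
Qed.

(** All integrals are first moved to the one measure [mu] that integrates 1/(1 + t^2). Dominated
    convergence then sends the real part to 0 and the imaginary part to the mass of the atom. *)
Lemma quadform_herglotz_cvg (v : 'cV[C]_2) :
  ccvg (fun n => (eta n)%:C * quadform (M (lam +i* eta n)) v)
    ('i%C * quadform (Sigma [set lam]) v).
Proof.
have [mu [Bmu [I0 _] _]] := SN v.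
set Q0 := quadform (Remx (M (0 +i* 1))) v.
pose K n t := herglotz_kernel (lam +i* eta n) t.
have mu1 : mu [set lam] = (Re (quadform (Sigma [set lam]) v))%:E.
  by apply: Bmu; exact: bounded_borel1.
have qreal : 'i%C * quadform (Sigma [set lam]) v =
    0 +i* Re (quadform (Sigma [set lam]) v).
  have := Spsd.1 _ bounded_borel1 v; rewrite lecE /= => /andP[/eqP i0 _].
  by apply: complex_ext; rewrite !partsE /= ?i0; ring.
rewrite qreal.
have repr n : [/\ mu.-integrable setT (EFin \o (fun t => eta n * Re (K n t))),
    mu.-integrable setT (EFin \o (fun t => eta n * Im (K n t))) &
    (eta n)%:C * quadform (M (lam +i* eta n)) v =
      (\int[mu]_t (eta n * Re (K n t))) +i* (\int[mu]_t (eta n * Im (K n t)))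
      + (eta n)%:C * Q0].
  have zn : Im (lam +i* eta n) != 0 by rewrite /= lt0r_neq0.
  have [mun [Bn [Ir Ii] E]] := SM zn v.
  (* The measure [mun] obtained at the n-th point coincides with [mu]. *)
  have eqm : forall A : set (measurableTypeR R), measurable A -> A `<=` setT ->
      mu A = mun A.
    move=> A mA _; apply: eq_measure_bounded mA => B BB.
    by rewrite (Bn B BB) (Bmu B BB).
  have tr (f : R -> R) : mun.-integrable setT (EFin \o f) ->
      mu.-integrable setT (EFin \o f) /\
      \int[mu]_t (eta n * f t) = eta n * \int[mun]_t f t.
    move=> If; have If' : mu.-integrable setT (EFin \o f).
      move/integrableP : If => [mf If]; apply/integrableP; split => //.
      by rewrite (eq_measure_integral mun eqm).
    split => //; rewrite RintegralZl//; congr (_ * fine _).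
    exact: (eq_measure_integral mun eqm).
  have [Ir' Er] := tr _ Ir; have [Ii' Ei] := tr _ Ii.
  split; [exact: (integrableZl _ _ Ir')|exact: (integrableZl _ _ Ii')|].
  rewrite Er Ei.
  have -> : quadform (M (lam +i* eta n)) v =
      cintegral mun setT (herglotz_kernel (lam +i* eta n)) + Q0.
    by rewrite -E quadformB subrK.
  by apply: complex_ext; rewrite !partsE /=; ring.
have -> : (fun n => (eta n)%:C * quadform (M (lam +i* eta n)) v) =
   (fun n => (\int[mu]_t (eta n * Re (K n t))) +i* (\int[mu]_t (eta n * Im (K n t)))
      + (eta n)%:C * Q0).
  by apply/funext => n; have [] := repr n.
(* The contribution of Re M(i) does not depend on n, so the factor eta removes it in the limit. *)
rewrite -[X in ccvg _ X]addr0; apply: ccvgD; last first.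
  rewrite -(mul0r Q0); apply: ccvgM; last exact: ccvg_cst.
  by split => /=; [exact: eta_cvg|exact: cvg_cst].
pose g (t : R) := 4 * (1 + lam ^+ 2) * (1 + t ^+ 2)^-1.
have Ig : mu.-integrable setT (EFin \o g).
  exact: (integrableZl _ (4 * (1 + lam ^+ 2)) I0).
have dom (f : nat -> R -> R) (l : R -> R) :
    (forall n, mu.-integrable setT (EFin \o f n)) ->
    (forall t, f n t @[n --> \oo] --> l t) ->
    (forall n t, `|f n t| <= g t) -> (\int[mu]_t (l t)%:E)%E \is a fin_num ->
    \int[mu]_t f n t @[n --> \oo] --> \int[mu]_t l t.
  move=> If fl fg lfin; apply: fine_cvg; rewrite fineK//.
  apply: (@dominated_cvg _ _ R mu setT measurableT (fun n => EFin \o f n) (EFin \o l)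
    (EFin \o g)) => //.
  - by move=> n; exact: measurable_int (If n).
  - by move=> t _; apply/fine_cvgP; split; [exact: nearW|exact: fl].
  - by move=> n t _; rewrite /= lee_fin; exact: fg.
apply: ccvgI.
  have E0 : (\int[mu]_t (0 : R)%:E = 0)%E by rewrite integral0.
  have Z : \int[mu]_t (0 : R) = 0 by rewrite /Rintegral E0.
  have fin0 : (\int[mu]_t (0 : R)%:E)%E \is a fin_num by rewrite E0.
  have := dom (fun n t => eta n * Re (K n t)) (fun=> 0) _ _ _ fin0.
  rewrite Z; apply.
  - by move=> n; have [] := repr n.
  - by move=> t; have [h _] := herglotz_kernel_cvg lam t; exact: h.
  - by move=> n t; have [] := herglotz_kernel_bound lam t (eta_gt0 n) (eta_le1 n).
have E1 : (\int[mu]_t (\1_[set lam] t)%:E)%E = mu [set lam].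
  have mS : measurable ([set lam] : set (measurableTypeR R)) by exact: measurable_set1.
  by rewrite integral_indic// setIT.
have Z : \int[mu]_t (\1_[set lam] t) = Re (quadform (Sigma [set lam]) v).
  by rewrite /Rintegral E1 mu1.
have fin1 : (\int[mu]_t (\1_[set lam] t)%:E)%E \is a fin_num by rewrite E1 mu1.
have := dom (fun n t => eta n * Im (K n t)) (\1_[set lam]) _ _ _ fin1.
rewrite Z; apply.
- by move=> n; have [] := repr n.
- by move=> t; have [_ h] := herglotz_kernel_cvg lam t; exact: h.
- by move=> n t; have [] := herglotz_kernel_bound lam t (eta_gt0 n) (eta_le1 n).
Qed.

Lemma herglotz_cvg :
  ccvg (fun n => (eta n)%:C * M (lam +i* eta n) 0 0) ('i%C * Sigma [set lam] 0 0) /\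
  ccvg (fun n => (eta n)%:C * M (lam +i* eta n) 1 0) ('i%C * Sigma [set lam] 1 0).
Proof.
have c10 := quadform_herglotz_cvg (col2 1 0).
have c01 := quadform_herglotz_cvg (col2 0 1).
have c11 := quadform_herglotz_cvg (col2 1 1).
have c1i := quadform_herglotz_cvg (col2 1 'i%C).
split.
  by move: c10; rewrite quadform_e0; under eq_fun do rewrite quadform_e0.
have := ccvgM (ccvg_cst 2^-1) (ccvgD (ccvgB c11 (ccvgD c10 c01))
   (ccvgM (ccvg_cst 'i%C) (ccvgB c1i (ccvgD c10 c01)))).
congr ccvg; last by rewrite [RHS]mulrC quadform_polarization; ring.
by apply/funext => n; rewrite [in RHS]quadform_polarization; ring.
Qed.

End limit.
End herglotz.

(** * Weyl solutions *)

Section conjugation.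
Context {R : realType}.
Implicit Types x y : R[i].
Lemma conjcM x y : conjc (x * y) = conjc x * conjc y. Proof. exact: rmorphM. Qed.
Lemma conjcD x y : conjc (x + y) = conjc x + conjc y. Proof. exact: rmorphD. Qed.
Lemma conjcN x : conjc (- x) = - conjc x. Proof. exact: rmorphN. Qed.
End conjugation.

Section boundary_constants.
Context {R : realType}.
Local Notation C := (R[i]).
Implicit Types (alpha : option C).

(* The boundary condition reads [s f'(0) + c f(0) = 0] with [s] real and
   [s^2 + |c|^2 = 1], uniformly in [alpha]. *)
Definition bc_s alpha : C := if alpha is Some a then (japanese_bracket a)^-1 else 0.
Definition bc_c alpha : C := if alpha is Some a then (japanese_bracket a)^-1 * a else 1.

Lemma japanese_bracket_gt0 (a : C) : 0 < Num.sqrt (1 + cabs a ^+ 2).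
Proof. by rewrite sqrtr_gt0 ltr_wpDr ?sqr_ge0. Qed.

Lemma japanese_bracketV (a : C) :
  (japanese_bracket a)^-1 = (Num.sqrt (1 + cabs a ^+ 2))^-1%:C.
Proof.
by rewrite /japanese_bracket fmorphV.
Qed.

Lemma bc_sJ alpha : conjc (bc_s alpha) = bc_s alpha.
Proof.
by case: alpha => [a|]; rewrite /bc_s ?conjc0// japanese_bracketV conjc_real.
Qed.

Lemma bc_s2c2 alpha : bc_s alpha * bc_s alpha + bc_c alpha * conjc (bc_c alpha) = 1.
Proof.
case: alpha => [a|]; rewrite /bc_s /bc_c; last by rewrite mul0r add0r conjc1 mulr1.
have J := bc_sJ (Some a); rewrite /bc_s in J; rewrite conjcM J.
set j := (japanese_bracket a)^-1.
have -> : j * j + j * a * (j * conjc a) = j * j * (1 + a * conjc a) by ring.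
rewrite mulcJ /j japanese_bracketV -rmorphM -(rmorph1 (real_complex R)) -rmorphD -rmorphM.
congr real_complex_def; have h := japanese_bracket_gt0 a.
have E : Num.sqrt (1 + cabs a ^+ 2) ^+ 2 = 1 + cabs a ^+ 2.
  by rewrite sqr_sqrtr// addr_ge0 ?sqr_ge0.
by rewrite -[X in _ * X]E; field; exact: lt0r_neq0.
Qed.

Lemma bcE alpha (f f' : C) : bc alpha f f' <-> bc_s alpha * f' + bc_c alpha * f = 0.
Proof.
case: alpha => [a|] /=; last by rewrite /bc_s /bc_c mul0r add0r mul1r.
rewrite /bc_s /bc_c -mulrA -mulrDr; split => [->|]; first by rewrite mulr0.
have j0 : (japanese_bracket a)^-1 != 0.
  rewrite invr_eq0 -(rmorph0 (real_complex R)) (inj_eq (@complexI R)).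
  exact/lt0r_neq0/japanese_bracket_gt0.
by move=> /eqP; rewrite mulf_eq0 (negbTE j0)/= => /eqP.
Qed.

Lemma ellE alpha (f f' : C) :
  ell alpha f f' = conjc (bc_c alpha) * f' - bc_s alpha * f.
Proof.
case: alpha => [a|]; last by rewrite /ell /bc_s /bc_c conjc1 mul1r mul0r subr0.
have J := bc_sJ (Some a); rewrite /bc_s in J.
rewrite /ell /bc_s /bc_c conjcM J; set j := (japanese_bracket a)^-1; ring.
Qed.

(** The boundary condition describes the line spanned by the unit vector (-s, c), and [ell] is the
    coordinate along it, namely the inner product with that vector. *)
Lemma bc_ell alpha (f f' : C) (l := ell alpha f f') : bc alpha f f' ->
  f = - (bc_s alpha * l) /\ f' = bc_c alpha * l.
Proof.
move=> /bcE B; have E := bc_s2c2 alpha; rewrite /l ellE.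
set s := bc_s alpha in B E *; set c := bc_c alpha in B E *; set d := conjc c in E *.
split.
  transitivity ((s * s + c * d) * f); first by rewrite E mul1r.
  transitivity (d * (s * f' + c * f) + - (s * (d * f' - s * f))); first by ring.
  by rewrite B; ring.
transitivity ((s * s + c * d) * f'); first by rewrite E mul1r.
transitivity (s * (s * f' + c * f) + c * (d * f' - s * f)); first by ring.
by rewrite B; ring.
Qed.

Lemma SmxE alpha : [/\ Smx alpha 0 0 = bc_s alpha, Smx alpha 0 1 = 0,
  Smx alpha 1 0 = 0 & Smx alpha 1 1 = bc_s alpha].
Proof.
case: alpha => [a|]; rewrite /Smx /bc_s !mxE //=.
by rewrite !mulr1n !mulr0n !mulr1 !mulr0.
Qed.

Lemma CmxE alpha : [/\ Cmx alpha 0 0 = 0, Cmx alpha 0 1 = bc_c alpha,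
  Cmx alpha 1 0 = conjc (bc_c alpha) & Cmx alpha 1 1 = 0].
Proof.
case: alpha => [a|]; rewrite /Cmx /bc_c; last by rewrite conjc1 !mxE.
have J := bc_sJ (Some a); rewrite /bc_s in J; rewrite conjcM J.
have Z (k : C) (A : 'M[C]_2) i j : (k *: A) i j = k * A i j by rewrite mxE.
by rewrite !Z !epsmxE !mxE !mulr0.
Qed.

End boundary_constants.

Section weyl_solution.
Context {R : realType}.
Local Notation C := (R[i]).
Local Notation leb := (@lebesgue_measure R).

(** The first column of Theta - Phi M. The conditions at 0 prescribe eps Phi' and eps Theta', so the
    rows of the derivatives are read off in swapped order. *)
Lemma weyl_column (q q1 : R -> C) alpha (z : C) M :
  cmeasurable (@Rplus R) q1 -> ae_equal q q1 -> is_Mfunction q alpha z M ->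
  exists y1 y2 p1 p2, [/\ sys_solution q1 z y1 y2 p1 p2, L2 y1, L2 y2 &
    [/\ y1 0 = - (bc_s alpha * M 0 0), y2 0 = conjc (bc_c alpha) - bc_s alpha * M 1 0,
        p1 0 = conjc (bc_c alpha) * M 0 0 & p2 0 = bc_s alpha + bc_c alpha * M 1 0]].
Proof.
move=> mq qq1 [Phi [Phi' [Psi [Psi' [[SP ST] [P0 P0'] [T0 T0'] L]]]]].
have t0 := mx_solution_column mq qq1 0 ST.
have p0 := mx_solution_column mq qq1 0 SP.
have p1 := mx_solution_column mq qq1 1 SP.
have := sys_solutionD t0 (sys_solutionD (sys_solutionZ (- M 0 0) p0)
  (sys_solutionZ (- M 1 0) p1)).
set y1 := fun x => Psi x 0 0 + _; set y2 := fun x => Psi x 1 0 + _.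
set r1 := fun x => Psi' x 0 0 + _; set r2 := fun x => Psi' x 1 0 + _ => S.
have [S00 S01 S10 S11] := SmxE alpha; have [C00 C01 C10 C11] := CmxE alpha.
have eP j : Phi' 0 1 j = - Cmx alpha 0 j.
  by rewrite -(epsmxE (Phi' 0) j).1 P0' mxE.
have eP' j : Phi' 0 0 j = - Cmx alpha 1 j.
  by rewrite -(epsmxE (Phi' 0) j).2 P0' mxE.
have eT j : Psi' 0 1 j = Smx alpha 0 j by rewrite -(epsmxE (Psi' 0) j).1 T0'.
have eT' j : Psi' 0 0 j = Smx alpha 1 j by rewrite -(epsmxE (Psi' 0) j).2 T0'.
exists y1, y2, r1, r2; split => //.
- have := L 0 0; congr L2; apply/funext => x; rewrite !mxE sum2 /y1; ring.
- have := L 1 0; congr L2; apply/funext => x; rewrite !mxE sum2 /y2; ring.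
split.
- by rewrite /y1 T0 P0 S00 S01 C00; ring.
- by rewrite /y2 T0 P0 S10 S11 C10; ring.
- by rewrite /r1 eT' !eP' S10 C10 C11; ring.
- by rewrite /r2 eT !eP S00 C00 C01; ring.
Qed.

Lemma cauchy_schwarz2 (y1 y2 g1 g2 : R -> C) : L2 y1 -> L2 y2 -> L2 g1 -> L2 g2 ->
  inner g1 g1 + inner g2 g2 = 2 ->
  cabs (inner y1 g1 + inner y2 g2) ^+ 2 / 2 <= Re (inner y1 y1 + inner y2 y2).
Proof.
move=> L1 L2' G1 G2 G.
set B := inner y1 g1 + inner y2 g2.
(* Minus the coefficient of the projection onto (g1, g2), whose squared norm is 2; expanding the
   squared norm of y + k g >= 0 gives the claim. *)
pose k := - (B / 2).
have exp (y g : R -> C) : L2 y -> L2 g ->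
    inner (fun x => y x + k * g x) (fun x => y x + k * g x) =
    inner y y + conjc k * inner y g + k * conjc (inner y g) + k * conjc k * inner g g.
  move=> Ly Lg; have Lk := L2Z k Lg.
  rewrite innerDl//; last exact: L2D.
  rewrite !innerDr// innerZl// !innerZr// innerZl// -(innerC Ly Lg); ring.
have pos (f : R -> C) : L2 f -> 0 <= Re (inner f f).
  by move=> Lf; rewrite inner_self//=; apply: Rintegral_ge0 => x _; exact: sqr_ge0.
have Lk1 := L2D L1 (L2Z k G1); have Lk2 := L2D L2' (L2Z k G2).
have := addr_ge0 (pos _ Lk1) (pos _ Lk2); rewrite -cReD !exp//.
have -> : inner y1 y1 + conjc k * inner y1 g1 + k * conjc (inner y1 g1) +
    k * conjc k * inner g1 g1 + (inner y2 y2 + conjc k * inner y2 g2 +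
    k * conjc (inner y2 g2) + k * conjc k * inner g2 g2) =
   (inner y1 y1 + inner y2 y2) + conjc k * B + k * conjc B +
    k * conjc k * (inner g1 g1 + inner g2 g2).
  by rewrite /B conjcD; ring.
rewrite G.
have h2 : (2 : C)^-1 = (2^-1 : R)%:C by rewrite fmorphV rmorph_nat.
have -> : inner y1 y1 + inner y2 y2 + conjc k * B + k * conjc B + k * conjc k * 2 =
   inner y1 y1 + inner y2 y2 + - ((2^-1 : R)%:C * (B * conjc B)).
  rewrite /k conjcN conjcM h2 conjc_real.
  have e : (2^-1 : R)%:C * 2 = 1 :> C by rewrite -h2 mulVf// pnatr_eq0.
  transitivity (inner y1 y1 + inner y2 y2 - (2^-1 : R)%:C * (B * conjc B) * 2 +
    (2^-1 : R)%:C * (B * conjc B) * ((2^-1 : R)%:C * 2)); first by ring.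
  rewrite e; ring.
rewrite mulcJ -rmorphM [Re (_ + - _)]cReD cReN /=; lra.
Qed.

(** Fatou is applied to the sum of both squared moduli, since only their joint integral [a n] is
    known to converge. Square-integrability of each limit component follows by domination. *)
Lemma fatou_L2 (y1 y2 : nat -> R -> C) (Y1 Y2 : R -> C) (a : nat -> R) (s : R) :
  (forall n, L2 (y1 n)) -> (forall n, L2 (y2 n)) ->
  cmeasurable (@Rplus R) Y1 -> cmeasurable (@Rplus R) Y2 ->
  (forall x, 0 <= x -> ccvg (fun n => y1 n x) (Y1 x)) ->
  (forall x, 0 <= x -> ccvg (fun n => y2 n x) (Y2 x)) ->
  (forall n, Re (inner (y1 n) (y1 n) + inner (y2 n) (y2 n)) = a n) ->
  a n @[n --> \oo] --> s ->
  [/\ L2 Y1, L2 Y2 & Re (inner Y1 Y1 + inner Y2 Y2) <= s].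
Proof.
move=> Ly1 Ly2 mY1 mY2 c1 c2 ya as_.
pose f n x := cabs (y1 n x) ^+ 2 + cabs (y2 n x) ^+ 2.
pose F x := cabs (Y1 x) ^+ 2 + cabs (Y2 x) ^+ 2.
have mR := @measurable_Rplus R.
have If n : leb.-integrable Rplus (EFin \o f n).
  exact: (integrableD mR (Ly1 n).2 (Ly2 n).2).
have Ef n : (\int[leb]_(x in Rplus) (f n x)%:E)%E = (a n)%:E.
  rewrite -[LHS]fineK; last exact: (integrable_fin_num mR (If n)).
  congr EFin; rewrite -ya !inner_self//= -RintegralD//; [exact: (Ly1 n).2|exact: (Ly2 n).2].
have F0 x : 0 <= F x by rewrite addr_ge0 ?sqr_ge0.
have mcabs (Y : R -> C) : cmeasurable (@Rplus R) Y ->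
    measurable_fun (@Rplus R) (fun x => cabs (Y x) ^+ 2).
  move=> [mr mi]; under eq_fun do rewrite cabs2.
  by apply: measurable_funD; apply: measurable_funX.
have mF : measurable_fun (@Rplus R) F by apply: measurable_funD; exact: mcabs.
have cf x : 0 <= x -> f n x @[n --> \oo] --> F x.
  move=> x0; rewrite /f /F !cabs2; under eq_fun do rewrite !cabs2.
  have [a1 b1] := c1 x x0; have [a2 b2] := c2 x x0.
  by rewrite !expr2; under eq_fun do rewrite !expr2; do !apply: cvgD; apply: cvgM.
have IF : (\int[leb]_(x in Rplus) (F x)%:E <= s%:E)%E.
  have := fatou leb mR (f := fun n => EFin \o f n).
  have -> : (\int[leb]_(x in Rplus) limn_einf (fun n => (EFin \o f n) x) =
      \int[leb]_(x in Rplus) (F x)%:E)%E.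
    apply: eq_integral => x /set_mem; rewrite /Rplus /= in_itv/= andbT => x0.
    have c : (f n x)%:E @[n --> \oo] --> (F x)%:E.
      by apply/fine_cvgP; split; [exact: nearW|exact: cf (ltW x0)].
    by rewrite is_cvg_limn_einfE; [exact/cvg_lim|apply/cvg_ex; eexists; exact: c].
  have -> : (fun n => \int[leb]_(x in Rplus) (EFin \o f n) x)%E = (fun n => (a n)%:E).
    by apply/funext => n; rewrite -Ef.
  have ca : (a n)%:E @[n --> \oo] --> s%:E.
    by apply/fine_cvgP; split; [exact: nearW|exact: as_].
  have -> : limn_einf (fun n => (a n)%:E) = s%:E.
    by rewrite is_cvg_limn_einfE; [exact/cvg_lim|apply/cvg_ex; eexists; exact: ca].
  apply.
  - by move=> n; exact: measurable_int (If n).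
  - by move=> n x _; rewrite /= lee_fin addr_ge0 ?sqr_ge0.
have iF : leb.-integrable Rplus (EFin \o F).
  apply/integrableP; split; first exact/measurable_EFinP.
  under eq_integral do rewrite /= ger0_norm//.
  by apply: le_lt_trans IF _; exact: ltry.
have sub (Y : R -> C) : cmeasurable (@Rplus R) Y -> (forall x, cabs (Y x) ^+ 2 <= F x) -> L2 Y.
  move=> mY YF; split => //; apply: le_integrable iF => //.
    by apply/measurable_EFinP; exact: mcabs.
  by move=> x _; rewrite /= lee_fin !ger0_norm ?sqr_ge0.
have LY1 : L2 Y1 by apply: sub => // x; rewrite lerDl sqr_ge0.
have LY2 : L2 Y2 by apply: sub => // x; rewrite lerDr sqr_ge0.
split=> //; rewrite !inner_self//= -RintegralD//; [|exact: LY1.2|exact: LY2.2].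
by rewrite -lee_fin fineK//; exact: (integrable_fin_num mR iF).
Qed.

End weyl_solution.

(** * The atom of the spectral measure *)

Section atom.
Context {R : realType}.
Local Notation C := (R[i]).
Local Notation leb := (@lebesgue_measure R).

(* The first equation gives [S00 = |k| |l|], which turns the two bounds into
   [|l|^2 / 2 <= S00 <= |l|^2 / 2]. *)
Lemma rank_one_identity (l k S00 S10 : C) : l != 0 -> 0 <= S00 ->
  'i%C * S00 = k * conjc l -> 'i%C * S10 = k * l ->
  cabs l ^+ 2 / 2 <= Re S00 -> 2 * cabs k ^+ 2 <= Re S00 ->
  S00 = (1 / 2 * cabs l ^+ 2)%:C /\ S10 = l ^+ 2 / 2.
Proof.
move=> l0 S0 E0 E1 low up.
have i2 : ('i%C : C) * 'i%C = -1 by rewrite -expr2 sqr_i.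
have Sr : S00 = (Re S00)%:C.
  by move: S0; rewrite lecE => /andP[/eqP h _]; apply: complex_ext.
set s := Re S00 in low up Sr.
have L0 : 0 < cabs l ^+ 2.
  rewrite lt_neqAle sqr_ge0 andbT eq_sym sqrf_eq0; apply: contra l0 => /eqP h.
  by apply/eqP; exact: Normc.eq0_normc.
have s2 : s ^+ 2 = cabs k ^+ 2 * cabs l ^+ 2.
  have := congr1 (fun w : C => cabs w ^+ 2) E0.
  have cM (w w' : C) : cabs (w * w') ^+ 2 = cabs w ^+ 2 * cabs w' ^+ 2.
    by rewrite !cabs2 !partsE; ring.
  have cJ : cabs (conjc l) ^+ 2 = cabs l ^+ 2 by rewrite !cabs2 !partsE; ring.
  rewrite Sr !cM cJ => <-; rewrite !cabs2 /=; ring.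
have s0 : 0 < s by apply: lt_le_trans low; rewrite divr_gt0.
have sL : s = 1 / 2 * cabs l ^+ 2.
  have : s * (2 * s) <= s * cabs l ^+ 2.
    have := ler_wpM2r (ltW L0) up; rewrite -mulrA -s2; lra.
  by rewrite ler_pM2l//; lra.
split; first by rewrite Sr sL.
have two : (2 : C) != 0 by rewrite pnatr_eq0.
have c0 : conjc l != 0 by rewrite conjc_eq0.
(* The value of [S00] turns the first equation into i l conj l / 2 = k conj l; cancelling conj l
   determines [k] with its phase, and the second equation then gives [S10]. *)
have kl : k * 2 = 'i%C * l.
  apply: (mulIf c0); rewrite mulrAC -E0 Sr sL -[RHS]mulrA mulcJ -[LHS]mulrA.
  congr (_ * _).
  have -> : (2 : C) = (2 : R)%:C by rewrite rmorph_nat.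
  by rewrite -rmorphM; congr real_complex_def; field.
have i0 : ('i%C : C) != 0.
  by apply/eqP => h; move: i2; rewrite h mul0r => /eqP; rewrite eq_sym oppr_eq0 oner_eq0.
apply: (mulfI i0); rewrite E1; apply: (mulIf two).
by rewrite mulrAC kl mulrA mulfVK// expr2 mulrA.
Qed.

Section eigenvalue.
Variables (q q1 : R -> C) (K : R) (alpha : option C) (lam : R) (e e' : R -> C).
Hypothesis mq : cmeasurable (@Rplus R) q1.
Hypothesis qK : forall x, norm1 (q1 x) <= K.
Hypothesis qq1 : ae_equal q q1.
Hypothesis lam0 : 0 < lam.
Hypothesis ed : is_distinguished q alpha lam e e'.

Let l := ell alpha (e 0) (e' 0).
Let s := bc_s alpha.
Let c := bc_c alpha.

Let solF : sys_solution q1 lam%:C (fun x => conjc (e x)) e (fun x => conjc (e' x)) e'.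
Proof. exact: distinguished_solution ed. Qed.

Let Le : L2 e. Proof. by have [_ _ h _] := ed. Qed.

Let LJe : L2 (fun x => conjc (e x)). Proof. exact: L2J. Qed.

Let inner_ee : inner e e = 1.
Proof.
have [_ _ _ n1] := ed; rewrite inner_self//.
have r0 : 0 <= Rintegral leb Rplus (fun x => cabs (e x) ^+ 2).
  by apply: Rintegral_ge0 => x _; exact: sqr_ge0.
by rewrite -(sqr_sqrtr r0) -/(L2norm e) n1 expr1n.
Qed.

Let inner_JeJe : inner (fun x => conjc (e x)) (fun x => conjc (e x)) = 1.
Proof.
rewrite -inner_ee; apply: eq_cintegral => x _; rewrite conjcK mulrC //.
Qed.

Lemma distinguished_neq0 : ~ ae_equal e (fun=> 0).
Proof.
move=> e0; have L0 : L2 (fun=> 0 : C).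
  by have := L2Z 0 Le; congr L2; apply/funext => x; rewrite mul0r.
have : inner e e = 0.
  rewrite (inner_ae Le.1 L0.1 Le e0).
  have -> : (fun=> 0 : C) = (fun x => 0 * e x) by apply/funext => x; rewrite mul0r.
  by rewrite innerZr// conjc0 mul0r.
by rewrite inner_ee => /eqP; rewrite oner_eq0.
Qed.

Let e0E : e 0 = - (s * l). Proof. by have [_ /bc_ell[]] := ed. Qed.
Let e'0E : e' 0 = c * l. Proof. by have [_ /bc_ell[]] := ed. Qed.

(** If [l] were 0, all initial data of (conj e, e) would vanish, and uniqueness would make [e] zero
    against its normalisation. *)
Lemma ell_neq0 : l != 0.
Proof.
apply/eqP => l0; apply: distinguished_neq0.
apply: aeW => x; rewrite /Rplus /= in_itv/= andbT => x0.
have [|||| _ ->//] := sys_solution_unique0 qK solF _ _ _ _ (ltW x0).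
- by rewrite e0E l0 mulr0 oppr0 conjc0.
- by rewrite e0E l0 mulr0 oppr0.
- by rewrite e'0E l0 mulr0 conjc0.
- by rewrite e'0E l0 mulr0.
Qed.

(** Both y2 and [e] are eigenvectors of |H|, so simplicity makes them proportional, and the system
    carries the factor over to the first component and the derivatives. The condition on conj y1 is
    the row of F'(0) + A F(0) = 0 that contains conj alpha. *)
Lemma eigenspace_line (absH : @op R) y1 y2 p1 p2 :
  is_modulus (schrodinger q alpha) absH -> simple_eigenvalue absH lam%:C ->
  sys_solution q1 lam%:C y1 y2 p1 p2 -> L2 y1 -> L2 y2 ->
  bc alpha (y2 0) (p2 0) -> bc alpha (conjc (y1 0)) (conjc (p1 0)) ->
  exists k, forall x, 0 <= x ->
    [/\ y1 x = k * conjc (e x), y2 x = k * e x, p1 x = k * conjc (e' x) & p2 x = k * e' x].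
Proof.
move=> aH sH sol L1 L2' b2 b1.
have eig (u1 u2 r1 r2 : R -> C) : sys_solution q1 lam%:C u1 u2 r1 r2 -> L2 u1 -> L2 u2 ->
    bc alpha (u2 0) (r2 0) -> bc alpha (conjc (u1 0)) (conjc (r1 0)) ->
    eigenvector absH lam%:C u2.
  move=> su Lu1 Lu2 B2 B1; apply: (modulus_eigenvector aH lam0).
  exists (fun x => lam%:C * u1 x); split.
    exact: (schrodinger_system mq qK qq1 su Lu1 Lu2 B2).
  exact: (adjoint_schrodinger_system mq qK qq1 su Lu1 Lu2 B1).
have ey := eig _ _ _ _ sol L1 L2' b2 b1.
have [_ be _ _] := ed.
have ee : eigenvector absH lam%:C e.
  by apply: (eig _ _ _ _ solF) => //; rewrite !conjcK.
have [k Ek] := simple_eigenvalue_proportional sH ee ey distinguished_neq0.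
exists k => x x0; apply: (sys_proportional _ sol solF Ek x0).
by rewrite -(rmorph0 (real_complex R)) (inj_eq (@complexI R)) lt0r_neq0.
Qed.

Section sequence.
Variables (M : nat -> 'M[C]_2) (S00 S10 : C).
Local Notation z n := (lam +i* harmonic n).
Hypothesis MM : forall n, is_Mfunction q alpha (z n) (M n).
Hypothesis S0 : 0 <= S00.
Hypothesis cM0 : ccvg (fun n => (harmonic n)%:C * M n 0 0) ('i%C * S00).
Hypothesis cM1 : ccvg (fun n => (harmonic n)%:C * M n 1 0) ('i%C * S10).

Lemma weyl_limit (absH : @op R) :
  is_modulus (schrodinger q alpha) absH -> simple_eigenvalue absH lam%:C ->
  S00 = (1 / 2 * cabs l ^+ 2)%:C /\ S10 = l ^+ 2 / 2.
Proof.
move=> aH sH.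
have ss : conjc s = s by exact: bc_sJ.
have sc : s * s + c * conjc c = 1 by exact: bc_s2c2.
have /choice[Y HY] : forall n, exists Y : (R -> C) * (R -> C) * (R -> C) * (R -> C),
    [/\ sys_solution q1 (z n) Y.1.1.1 Y.1.1.2 Y.1.2 Y.2, L2 Y.1.1.1, L2 Y.1.1.2 &
    [/\ Y.1.1.1 0 = - (s * M n 0 0), Y.1.1.2 0 = conjc c - s * M n 1 0,
        Y.1.2 0 = conjc c * M n 0 0 & Y.2 0 = s + c * M n 1 0]].
  move=> n; have [y1 [y2 [p1 [p2 H]]]] := weyl_column mq qq1 (MM n).
  by exists (y1, y2, p1, p2).
pose h n : C := (harmonic n)%:C.
pose y1 n x := h n * (Y n).1.1.1 x; pose y2 n x := h n * (Y n).1.1.2 x.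
pose p1 n x := h n * (Y n).1.2 x; pose p2 n x := h n * (Y n).2 x.
pose m0 n := h n * M n 0 0; pose m1 n := h n * M n 1 0.
have sol n : sys_solution q1 (z n) (y1 n) (y2 n) (p1 n) (p2 n).
  by apply: sys_solutionZ; have [] := HY n.
have Ly1 n : L2 (y1 n) by apply: L2Z; have [] := HY n.
have Ly2 n : L2 (y2 n) by apply: L2Z; have [] := HY n.
have i1 n : y1 n 0 = - (s * m0 n).
  by have [_ _ _ [E _ _ _]] := HY n; rewrite /y1 E /m0; ring.
have i2 n : y2 n 0 = h n * conjc c - s * m1 n.
  by have [_ _ _ [_ E _ _]] := HY n; rewrite /y2 E /m1; ring.
have i3 n : p1 n 0 = conjc c * m0 n.
  by have [_ _ _ [_ _ E _]] := HY n; rewrite /p1 E /m0; ring.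
have i4 n : p2 n 0 = h n * s + c * m1 n.
  by have [_ _ _ [_ _ _ E]] := HY n; rewrite /p2 E /m1; ring.
have hJ n : conjc (h n) = h n by exact: conjc_real.
have h0 n : h n != 0.
  rewrite -(rmorph0 (real_complex R)) (inj_eq (@complexI R)).
  exact/lt0r_neq0/harmonic_gt0.
have i0 : ('i%C : C) != 0 by rewrite eq_complex /= negb_and oner_eq0 orbT.
have zE n : z n = lam%:C + 'i%C * h n.
  by apply: complex_ext; rewrite !partsE /=; ring.
have zJ n : conjc (z n) = lam%:C - 'i%C * h n.
  by apply: complex_ext; rewrite !partsE /=; ring.
(* Lagrange's identity of the solution with itself: z - conj z = 2 i eta, the terms with M_21
   cancel, and the remaining coefficient is s^2 + |c|^2 = 1. *)
have normY n : Re (inner (y1 n) (y1 n) + inner (y2 n) (y2 n)) = Im (m0 n).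
  have := sys_lagrange mq qK (sol n) (sol n) (Ly1 n) (Ly2 n) (Ly1 n) (Ly2 n).
  rewrite i1 i2 i3 i4 !conjcD !conjcN !conjcM ss conjcK hJ zJ zE.
  set I := inner _ _ + _ => E.
  have : ('i%C * h n) * (I + I) = h n * (m0 n - conjc (m0 n)) * (s * s + c * conjc c).
    by transitivity ((lam%:C + 'i%C * h n - (lam%:C - 'i%C * h n)) * I);
      [ring|rewrite E /m0 /m1 !conjcM !hJ; ring].
  rewrite sc mulr1 -mulrA mulrCA => /(mulfI (h0 n)).
  clear E; move: (m0 n) I => m I.
  move=> /(congr1 (@complex.Im R)); rewrite !partsE /=; lra.
(* Here the spectral factor is z - lam = i eta and every entry of M cancels, because [e] satisfies
   the boundary condition; the value is the same for all n. *)
have crossY n : inner (y1 n) (fun x => conjc (e x)) + inner (y2 n) e = 'i%C * l.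
  have := sys_lagrange mq qK (sol n) solF (Ly1 n) (Ly2 n) LJe Le.
  rewrite i1 i2 i3 i4 e0E e'0E !conjcK conjc_real zE.
  rewrite !conjcN !conjcM ss.
  set I := inner _ _ + _ => E.
  have : ('i%C * h n) * I = - (h n * l * (s * s + c * conjc c)).
    by transitivity ((lam%:C + 'i%C * h n - lam%:C) * I); [ring|rewrite E; ring].
  rewrite sc mulr1 -mulrA mulrCA -mulrN => /(mulfI (h0 n)) H.
  apply: (mulfI i0); rewrite H mulrA -expr2 sqr_i mulN1r; ring.
have cz : ccvg (fun n => z n) lam%:C.
  by apply: ccvgI; [exact: cvg_cst|exact: cvg_harmonic].
have ch : ccvg h 0 by apply: ccvgI; [exact: cvg_harmonic|exact: cvg_cst].
have cst_ := @ccvg_cst R.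
have c1 : ccvg (fun n => y1 n 0) (- (s * ('i%C * S00))).
  under eq_fun do rewrite i1.
  by apply: ccvgN; apply: ccvgM.
have c2 : ccvg (fun n => y2 n 0) (- (s * ('i%C * S10))).
  under eq_fun do rewrite i2.
  rewrite -[- _]add0r -(mul0r (conjc c)).
  by apply: ccvgB; apply: ccvgM.
have c3 : ccvg (fun n => p1 n 0) (conjc c * ('i%C * S00)).
  under eq_fun do rewrite i3.
  exact: ccvgM.
have c4 : ccvg (fun n => p2 n 0) (c * ('i%C * S10)).
  under eq_fun do rewrite i4.
  rewrite -[X in ccvg _ X]add0r -(mul0r s).
  by apply: ccvgD; apply: ccvgM.
have [Y1 [Y2 [P1 [P2 [solY cY1 cY2 [j1 j2 j3 j4]]]]]] :=
  sys_solution_lim qK sol cz c1 c2 c3 c4.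
have cs : Im (m0 n) @[n --> \oo] --> Re S00.
  by have [_] := cM0; rewrite cImM /= mul0r mul1r add0r.
have [LY1 LY2 up] := fatou_L2 Ly1 Ly2
  (primitive_cmeasurable (let: And4 a _ _ _ := solY in a))
  (primitive_cmeasurable (let: And4 _ a _ _ := solY in a)) cY1 cY2 normY cs.
(* The initial data free of M carried the factor eta and are gone in the limit; what remains is a
   multiple of the boundary vector. *)
have b2 : bc alpha (Y2 0) (P2 0).
  by apply/bcE; rewrite j2 j4 -/s -/c; ring.
have b1 : bc alpha (conjc (Y1 0)) (conjc (P1 0)).
  apply/bcE; rewrite j1 j3 -/s -/c conjcN !conjcM ss conjcK; ring.
have [k Hk] := eigenspace_line aH sH solY LY1 LY2 b2 b1.
have [k1 k2 k3 k4] := Hk 0 (lexx 0).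
(* The limit's initial data are paired with the unit boundary vector, once through their limits and
   once through k (conj e, e). *)
have E0 : 'i%C * S00 = k * conjc l.
  transitivity (- (s * Y1 0) + c * P1 0).
    by rewrite j1 j3 -[LHS]mul1r -sc; ring.
  by rewrite k1 k3 e0E e'0E conjcN !conjcM ss -[RHS]mul1r -sc; ring.
have E1 : 'i%C * S10 = k * l.
  transitivity (- (s * Y2 0) + conjc c * P2 0).
    by rewrite j2 j4 -[LHS]mul1r -sc; ring.
  by rewrite k2 k4 e0E e'0E -[RHS]mul1r -sc; ring.
apply: (rank_one_identity ell_neq0 S0 E0 E1).
  have il : cabs ('i%C * l) ^+ 2 = cabs l ^+ 2 by rewrite !cabs2 !partsE /=; ring.
  have low n : cabs l ^+ 2 / 2 <= Im (m0 n).
    rewrite -normY -il -(crossY n); apply: cauchy_schwarz2 => //.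
    by rewrite inner_ee inner_JeJe.
  by rewrite -(cvg_lim _ cs)//; apply: limr_ge; [apply/cvg_ex; eexists; exact: cs|exact: nearW].
(* Fatou bounds the right-hand side; each of the two components has squared norm |k|^2. *)
suff -> : 2 * cabs k ^+ 2 = Re (inner Y1 Y1 + inner Y2 Y2) by [].
have -> : inner Y1 Y1 = inner (fun x => k * conjc (e x)) (fun x => k * conjc (e x)).
  apply: eq_cintegral => x; rewrite /Rplus /= in_itv/= andbT => x0.
  by have [-> _ _ _] := Hk x (ltW x0).
have -> : inner Y2 Y2 = inner (fun x => k * e x) (fun x => k * e x).
  apply: eq_cintegral => x; rewrite /Rplus /= in_itv/= andbT => x0.
  by have [_ -> _ _] := Hk x (ltW x0).
rewrite !innerZl ?innerZr ?inner_ee ?inner_JeJe//; try exact: L2Z.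
rewrite mulr1 mulcJ cReD /=; ring.
Qed.

End sequence.
End eigenvalue.
End atom.

Theorem theorem1p13 (R : realType) (q : R -> R[i])
  (q_meas : lebesgue_measurable q)
  (q_bounded : exists K : R, forall x : R, 0 < x -> cabs (q x) <= K)
  (alpha : option R[i])
  (nu : {measure set (measurableTypeR R) -> \bar R}) (psi : R -> R[i])
  (nu_psi : is_spectral_pair q alpha nu psi)
  (absH : @op R) (absH_modulus : is_modulus (schrodinger q alpha) absH)
  (lam : R) (lam_gt0 : 0 < lam)
  (lam_simple : simple_eigenvalue absH lam%:C)
  (e e' : R -> R[i]) (e_dist : is_distinguished q alpha lam e e') :
  let l := ell alpha (e 0) (e' 0) in
  [/\ l <> 0,
      nu [set lam] = (1 / 2 * cabs l ^+ 2)%:E,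
      psi lam = conjc (l ^+ 2) / (cabs l ^+ 2)%:C &
      cabs (psi lam) = 1].
Proof.
move=> l.
have [q1 [K [mq qK qq1]]] := bounded_borel_representative q_meas q_bounded.
have [_ _ _ _ [Sigma [Spsd [N SN] [M HM]] dens]] := nu_psi.
have l0 : l != 0 := ell_neq0 mq qK qq1 e_dist.
have SM z : Im z != 0 -> mx_integral Sigma (herglotz_kernel z) (M z - Remx (M (0 +i* 1))).
  by move=> /HM[].
have [cM0 cM1] := herglotz_cvg lam Spsd SN SM.
have S0 : 0 <= Sigma [set lam] 0 0.
  by have := Spsd.1 _ (bounded_borel1 lam) (col2 1 0); rewrite quadform_e0.
have MM n : is_Mfunction q alpha (lam +i* harmonic n) (M (lam +i* harmonic n)).
  by have [] := HM (lam +i* harmonic n); rewrite //= lt0r_neq0// harmonic_gt0.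
have [E0 E1] := weyl_limit mq qK qq1 lam_gt0 e_dist MM S0 cM0 cM1 absH_modulus lam_simple.
have mS : measurable ([set lam] : set (measurableTypeR R)) by exact: measurable_set1.
(* The density has entry 1 at (0,0) and conj psi at (1,0), so these two entries yield nu({lam}) and
   conj psi(lam) nu({lam}). *)
have [[I00 _] D00] := dens _ (bounded_borel1 lam) 0 0.
have [_ D10] := dens _ (bounded_borel1 lam) 1 0.
(* Finiteness comes from integrability of the constant entry 1 over the singleton; it allows [fine]
   to be undone below. *)
have nufin : (nu [set lam] < +oo)%E.
  have /integrableP[_] := I00.
  under eq_integral do rewrite mxE /= normr1.
  by rewrite integral_cst// mul1e.
have atomE (f : R -> R) : Rintegral nu [set lam] f = f lam * fine (nu [set lam]).
  transitivity (Rintegral nu [set lam] (cst (f lam))); last by rewrite Rintegral_cst.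
  by apply: eq_Rintegral => t /set_mem /= ->.
have nuE : fine (nu [set lam]) = 1 / 2 * cabs l ^+ 2.
  have := D00; rewrite E0 => /(congr1 (@complex.Re R)) /= ->.
  by rewrite atomE mxE /= mul1r.
have nu1 : nu [set lam] = (1 / 2 * cabs l ^+ 2)%:E.
  by rewrite -nuE fineK// ge0_fin_numE.
have psiE : Sigma [set lam] 1 0 = conjc (psi lam) * (fine (nu [set lam]))%:C.
  rewrite D10; apply: complex_ext; rewrite !partsE /= mulr0 atomE mxE /=.
    by rewrite cReJ subr0.
  by rewrite cImJ add0r.
have L0 : cabs l ^+ 2 != 0.
  by rewrite sqrf_eq0; apply: contra l0 => /eqP h; apply/eqP; exact: Normc.eq0_normc.
have LC0 : (cabs l ^+ 2)%:C != 0.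
  by rewrite -(rmorph0 (real_complex R)) (inj_eq (@complexI R)).
have two : (2 : R[i]) != 0 by rewrite pnatr_eq0.
(* From l^2 / 2 = conj psi(lam) |l|^2 / 2 by conjugation; the mass |l|^2 / 2 is nonzero, so the
   value at the point [lam] is determined. *)
have psil : psi lam = conjc (l ^+ 2) / (cabs l ^+ 2)%:C.
  apply: (mulIf LC0); rewrite divfK//.
  have h2 : (2 : R[i])^-1 = (2^-1 : R)%:C by rewrite fmorphV rmorph_nat.
  have h3 : (1 / 2 * cabs l ^+ 2)%:C = 2^-1 * (cabs l ^+ 2)%:C :> R[i].
    by rewrite h2 -rmorphM div1r.
  have cv : conjc (2^-1 : R[i]) = 2^-1 by rewrite h2 conjc_real.
  have two' : (2 : R[i])^-1 != 0 by rewrite invr_eq0.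
  apply: (mulIf two'); rewrite -[in RHS]cv -conjcM -E1 psiE nuE h3.
  by rewrite conjcM conjcK conjcM cv conjc_real -mulrA [_ * 2^-1]mulrC.
split=> //; first exact/eqP.
have cl : cabs (conjc (l ^+ 2)) ^+ 2 = (cabs l ^+ 2) ^+ 2.
  by rewrite !cabs2 expr2 !partsE; ring.
have cc : cabs ((cabs l ^+ 2)%:C : R[i]) ^+ 2 = (cabs l ^+ 2) ^+ 2.
  by rewrite [LHS]cabs2 /= expr0n addr0.
have cpos (w : R[i]) : 0 <= cabs w by case: w => a b; exact: sqrtr_ge0.
apply/eqP; rewrite -(eqrXn2 (n := 2))//; apply/eqP; rewrite expr1n psil.
by rewrite /cabs Normc.normcM Normc.normcV exprMn exprVn -!/(cabs _) cl cc divff// expf_neq0.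
Qed.
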